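(* For every $p\in(1,2]$ there exist a constant $c_p\in(0,2)$ and a sequence $\eta_n\to0$ (both depending only on $p$) such that for every $n\in\mathbb{N}$, every $\mathbf{k}$ as below, and every $\lambda\in(2^{-n},c_p^{-n}]$, $$g_{p,\mathbf{k},n}(\lambda)\ \ge\ \Big(\frac{\big(\log2+\frac1n\log\lambda\big)^2}{2}+\eta_n\Big)\frac{n^2}{2^n}.$$
   Context: $\log$ is the natural logarithm. $\mathbf{k}=(k_1,\dots,k_{m+1})$ integers with $0=k_1<\cdots<k_{m+1}=n$. For $\mathbf{x}\in\mathbb{R}^n$ put $\mathbf{x}_j=(x_{k_j+1},\dots,x_{k_{j+1}})$, $\|\mathbf{x}\|_{p,\mathbf{k},n}=(\sum_{j=1}^m\|\mathbf{x}_j\|_2^p)^{1/p}$ ($\|\cdot\|_2$ Euclidean norm), $d(\mathbf{x},\mathbf{y})=\|\mathbf{y}-\mathbf{x}\|_{p,\mathbf{k},n}$, $B(\mathbf{x},r)=\{\mathbf{y}:d(\mathbf{x},\mathbf{y})\le r\}$, and $r_n$ is the radius with $\mathrm{vol}(B(\mathbf 0,r_n))=1$. For bounded measurable $S\subseteq\mathbb{R}^n$ and integer $t\ge1$ let $\hat Z_S(t)=\frac1{t!}\int_{S^t}\mathbf 1[d(\mathbf{x}_i,\mathbf{x}_j)\ge2r_n\ \forall i\ne j]\,d\mathbf{x}_1\cdots d\mathbf{x}_t$, $\hat Z_S(0)=1$, and $Z_S(\lambda)=\sum_{t\ge0}\lambda^t\hat Z_S(t)$. With $V=V(R)=\mathrm{vol}(B(\mathbf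 0,R))=(R/r_n)^n$, the pressure is $g_{p,\mathbf{k},n}(\lambda)=\lim_{R\to\infty}\frac1V\log Z_{B(\mathbf 0,R)}(\lambda)$ (if the limit does not exist, interpret it as the $\liminf$). *)

(* Defs.v *)
From HB Require Import structures.
From mathcomp Require Import all_boot all_order all_algebra.
From mathcomp Require Import all_classical all_reals all_analysis.
Set Implicit Arguments. Unset Strict Implicit. Unset Printing Implicit Defensive.
Import Order.TTheory GRing.Theory Num.Theory.
Import numFieldNormedType.Exports.
Local Open Scope classical_set_scope.
Local Open Scope ring_scope.

Section Defs.
Variable R : realType.

(* Points of R^N are represented as functions nat -> R; only the
   coordinates 0, ..., N-1 are used (coordinate i here is x_{i+1} of the paper). *)
Definition ncons (x : R) (y : nat -> R) : nat -> R :=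
  fun i => if i is i'.+1 then y i' else x.

(* N-dimensional Lebesgue integral of a nonnegative function, as an iterated
   integral of one-dimensional Lebesgue integrals (Tonelli). *)
Fixpoint iint (N : nat) (f : (nat -> R) -> \bar R) : \bar R :=
  if N is N'.+1 then
    (\int[@lebesgue_measure R]_x iint N' (fun y => f (ncons x y)))%E
  else f (fun _ => 0).

Definition vol (N : nat) (A : set (nat -> R)) : \bar R :=
  iint N (fun z => (\1_A z)%:E).

Definition block_norm (k : nat -> nat) (j : nat) (x : nat -> R) : R :=
  Num.sqrt (\sum_(k j <= i < k j.+1) x i ^+ 2).

Definition pk_norm (p : R) (m : nat) (k : nat -> nat) (x : nat -> R) : R :=
  powR (\sum_(j < m) powR (block_norm k j x) p) p^-1.

Definition pk_dist (p : R) (m : nat) (k : nat -> nat) (x y : nat -> R) : R :=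
  pk_norm p m k (fun i => y i - x i).

Definition pk_ball (p : R) (m : nat) (k : nat -> nat) (x : nat -> R) (r : R)
  : set (nat -> R) := [set y | pk_dist p m k x y <= r].

Definition origin : nat -> R := fun _ => 0.

Definition r_n (p : R) (m : nat) (k : nat -> nat) (n : nat) : R :=
  xget 0 [set r : R | 0 < r /\ vol n (pk_ball p m k origin r) = 1%:E].

(* the i-th point (in R^n) of a configuration z in R^{t n} *)
Definition cpt (n : nat) (z : nat -> R) (i : nat) : nat -> R :=
  fun j => if (j < n)%N then z (i * n + j)%N else 0.

Definition Zhat (p : R) (m : nat) (k : nat -> nat) (n : nat)
  (S : set (nat -> R)) (t : nat) : \bar R :=
  (((t`!)%:R)^-1 : R)%:E *
  iint (t * n) (fun z => (\1_[set z | (forall i, (i < t)%N -> S (cpt n z i)) /\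
       (forall i j, (i < t)%N -> (j < t)%N -> i <> j ->
          2 * r_n p m k n <= pk_dist p m k (cpt n z i) (cpt n z j))] z)%:E)%E.

Definition Zpart (p : R) (m : nat) (k : nat -> nat) (n : nat)
  (S : set (nat -> R)) (lam : R) : \bar R :=
  (\sum_(0 <= t <oo) ((lam ^+ t)%:E * Zhat p m k n S t))%E.

Definition pressure (p : R) (m : nat) (k : nat -> nat) (n : nat) (lam : R)
  : \bar R :=
  limf_einf (fun Rad : R =>
      ((fine (vol n (pk_ball p m k origin Rad)))^-1 *
        ln (fine (Zpart p m k n (pk_ball p m k origin Rad) lam)))%:E)
    (pinfty_nbhs R).

End Defs.

(* Main.v *)
(* Let Z = Z_S(lam) for a ball S, and let A/Z be the expected number of particles of the
   hard-core model, so that lam * (log Z)' = A/Z. Fix u in S and let v be lam times the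
   volume of the set of positions near u (at distance < 2 r_n) that are left free by the
   particles far from u. Given these, no particle is near u with probability at least
   e^-v >= e^-a (1 + a - v) for every a >= 0, by iterating the Georgii-Nguyen-Zessin
   equation, and by the same equation E[v] is at most the expected number of particles
   near u, divided by 1 - lam * kappa. Here kappa bounds the average volume, over a set
   of positions near u, of the part of the set that is near one of its points; uniform
   convexity of the p-norm puts the points near y that are closer to u than y is in a
   ball of radius 2 theta r_n with theta < 1, whence kappa = 2 (1 + (2 theta)^n), and
   lam * kappa is exponentially small when lam <= (1 + theta)^-n. Integrating over u,
   the probability of a void at u becomes A / (lam Z), and the number of particles near u
   at most 2^n A / Z. Optimizing a gives A/Z >= vol(S) 2^-n log(2^n lam) (1 - o(1)), and
   integrating in log lam, along which log Z is convex, yields the square. *)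
Require Import Defs.
From HB Require Import structures.
From mathcomp Require Import all_boot all_order all_algebra.
From mathcomp Require Import all_classical all_reals all_analysis.
From mathcomp Require Import measurable_realfun.
From mathcomp Require Import ring lra zify.
Set Implicit Arguments. Unset Strict Implicit. Unset Printing Implicit Defensive.
Import Order.TTheory GRing.Theory Num.Theory.
Import numFieldNormedType.Exports.
Local Open Scope classical_set_scope.
Local Open Scope ring_scope.

(** The obstacle is uniformity: the losses may depend on [n] and [p] only, whatever the number and
    the sizes of the blocks. Convexity is therefore proved for a single block, where the Euclidean
    parallelogram law is available, as an inequality linear in [p]-th powers, which sums over blocks
    with the same constant. Any [theta < 1] is enough, since it is raised to the power [n]: the
    fugacity only has to stay exponentially below [(2 * theta) ^- n], and [1 + theta] is the
    midpoint of [2 * theta] and [2]. No conditional law is ever built. Conditioning on the particles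
    far from [u] is replaced by observables that do not change when a particle near [u] is removed,
    and expectations by unnormalised series of nonnegative integrals, on which Tonelli applies
    freely; a subtraction is made only once finiteness is known. The gas lives on an arbitrary
    sigma-finite measure space, and the norm enters through two numbers, [kappa] and the volume
    [2 ^+ n] of an exclusion ball. The final bound holds in a container of any radius, so the
    existence of the limit is not an issue. *)

(* A copy of [nat -> T], carrying the sigma-algebra generated by the coordinates. *)
Definition sq (T : Type) := nat -> T.

(** * Sequence spaces and finite powers of a measure *)

Section sq_measurable.
Context d (T : measurableType d).

Definition sq_cyl : set (set (sq T)) :=
  [set A | exists i B, measurable B /\ A = (fun x : sq T => x i) @^-1` B].

(** An identity closed with [Qed], so that the display of [sq T] does not unify with that of [T]. *)
Definition sq_display : measure_display -> measure_display.
Proof. exact. Qed.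

HB.instance Definition _ := Pointed.copy (sq T) (nat -> T).

Let sq_set0 : <<s sq_cyl >> set0.
Proof. exact: sigma_algebra0. Qed.

Let sq_setC A : <<s sq_cyl >> A -> <<s sq_cyl >> (~` A).
Proof. exact: sigma_algebraC. Qed.

Let sq_bigcup (F : (set (sq T))^nat) : (forall i, <<s sq_cyl >> (F i)) ->
  <<s sq_cyl >> (\bigcup_i (F i)).
Proof. exact: sigma_algebra_bigcup. Qed.

HB.instance Definition _ := @isMeasurable.Build (sq_display d) (sq T)
  <<s sq_cyl >> sq_set0 sq_setC sq_bigcup.

Lemma measurable_coord (i : nat) : measurable_fun setT (fun x : sq T => x i).
Proof.
move=> _ Y mY; rewrite setTI; apply: sub_sigma_algebra.
by exists i, Y.
Qed.

Lemma measurable_fun_sq d' (U : measurableType d') (g : U -> sq T) :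
  (forall i, measurable_fun setT (fun u => g u i)) -> measurable_fun setT g.
Proof.
move=> mg; apply: (@measurability _ _ _ _ _ _ sq_cyl) => //.
move=> _ [_ [i [B [mB ->]]] <-].
exact: (mg i).
Qed.

End sq_measurable.

Definition scons (T : Type) (x : T) (y : sq T) : sq T :=
  fun i => if i is i'.+1 then y i' else x.
Definition stail (T : Type) (x : sq T) : sq T := fun i => x i.+1.
Definition sdel (T : Type) (i : nat) (x : sq T) : sq T :=
  fun j => if (j < i)%N then x j else x j.+1.

Lemma stail_scons (T : Type) (x : T) y : stail (scons x y) = y.
Proof. by apply/funext. Qed.
Lemma sdelS (T : Type) i (x : T) (y : sq T) :
  sdel i.+1 (scons x y) = scons x (sdel i y).
Proof. by apply/funext => -[|j] //=; rewrite /sdel /= ltnS. Qed.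

Section sq_measurable2.
Context d (T : measurableType d).

Lemma measurable_scons :
  measurable_fun setT (fun z : T * sq T => scons z.1 z.2).
Proof.
apply: measurable_fun_sq => -[|i] /=; first exact: measurable_fst.
exact: (measurableT_comp (@measurable_coord _ T i) measurable_snd).
Qed.

Lemma measurable_scons2 d' (U : measurableType d') (f : U -> T) (g : U -> sq T) :
  measurable_fun setT f -> measurable_fun setT g ->
  measurable_fun setT (fun u => scons (f u) (g u)).
Proof.
move=> mf mg; apply: measurable_fun_sq => -[|i] //=.
exact: (measurableT_comp (@measurable_coord _ T i) mg).
Qed.

Lemma measurable_stail : measurable_fun setT (@stail T).
Proof. by apply: measurable_fun_sq => i; exact: measurable_coord. Qed.

Lemma measurable_sdel i : measurable_fun setT (@sdel T i).
Proof.
by apply: measurable_fun_sq => j; rewrite /sdel; case: (j < i)%N; exact: measurable_coord.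
Qed.

Variables (R : realType) (m : {sigma_finite_measure set T -> \bar R}).

Section consm.
Variable nu : {sigma_finite_measure set (sq T) -> \bar R}.

Definition scons2 (z : T * sq T) : sq T := scons z.1 z.2.

(** The product is carried back to [sq T] itself, so that configurations of every size share one
    type and an observable is a family of functions on it indexed by [t]. *)
Definition consm : set (sq T) -> \bar R := pushforward (m \x nu)%E scons2.

Let consm_measure : {measure set (sq T) -> \bar R} :=
  measure_function_pushforward__canonical__measure_function_Measure
    (m \x nu)%E measurable_scons.

HB.instance Definition _ := isMeasure.Build _ _ _ consm
  (measure0 consm_measure) (@measure_ge0 _ _ _ consm_measure)
  (@measure_semi_sigma_additive _ _ _ consm_measure).

Lemma consm_sigma_finite : sigma_finite setT consm.
Proof.
have /sigma_finiteP[F [FT ndF Foo]] := sigma_finiteT m.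
have /sigma_finiteP[G [GT ndG Goo]] := sigma_finiteT nu.
exists (fun k => (fun x : sq T => x 0%N) @^-1` F k `&` @stail T @^-1` G k).
  apply/esym; rewrite -subTset => x _.
  have [i _ Fi] : (\bigcup_n F n) (x 0%N) by rewrite -FT.
  have [j _ Gj] : (\bigcup_n G n) (stail x) by rewrite -GT.
  (* Both exhaustions are increasing, so the larger index serves the head and the tail at once. *)
  exists (maxn i j) => //; split => /=.
  - by move: (x 0%N) Fi; exact/subsetPset/ndF/leq_maxl.
  - by move: (stail x) Gj; exact/subsetPset/ndG/leq_maxr.
move=> k; have [mF Fk] := Foo k; have [mG Gk] := Goo k; split.
  apply: measurableI; rewrite -[X in measurable X]setTI.
    exact: measurable_coord.
  exact: measurable_stail.
rewrite (_ : consm _ = (m \x nu)%E (F k `*` G k)).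
  by rewrite product_measure1E// lte_mul_pinfty// ge0_fin_numE.
by congr ((m \x nu)%E _); apply/seteqP; split => -[x y] /=; rewrite stail_scons.
Qed.

HB.instance Definition _ := Measure_isSigmaFinite.Build _ _ _ consm consm_sigma_finite.

Lemma integral_consm (f : sq T -> \bar R) : measurable_fun setT f ->
  (forall x, 0 <= f x)%E ->
  (\int[consm]_x f x = \int[m]_x \int[nu]_y f (scons x y))%E.
Proof.
move=> mf f0; rewrite /consm (ge0_integral_pushforward measurable_scons)//.
rewrite preimage_setT fubini_tonelli1//.
  by apply: measurableT_comp => //; exact: measurable_scons.
by move=> x /=.
Qed.

End consm.

Variable e0 : T.

(* The product of [N] copies of [m] on the first [N] coordinates; the other
   coordinates are frozen at [e0]. *)
Fixpoint pow (N : nat) : {sigma_finite_measure set (sq T) -> \bar R} :=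
  if N is N'.+1 then consm (pow N') else dirac ((fun _ => e0) : sq T).

Lemma integral_pow0 (f : sq T -> \bar R) : measurable_fun setT f ->
  (\int[pow 0]_x f x = f (fun=> e0))%E.
Proof. by move=> mf; rewrite integral_dirac// diracT mul1e. Qed.

Lemma integral_powS N (f : sq T -> \bar R) : measurable_fun setT f ->
  (forall x, 0 <= f x)%E ->
  (\int[pow N.+1]_x f x = \int[m]_x \int[pow N]_y f (scons x y))%E.
Proof. exact: integral_consm. Qed.

(** The recursion of [iint] over an arbitrary measure: the bridge from iterated integrals to
    integrals against [pow]. *)
Fixpoint giint (N : nat) (f : sq T -> \bar R) : \bar R :=
  if N is N'.+1 then (\int[m]_x giint N' (fun y => f (scons x y)))%E
  else f (fun=> e0).

Lemma giintE N (f : sq T -> \bar R) : measurable_fun setT f ->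
  (forall x, 0 <= f x)%E -> giint N f = (\int[pow N]_x f x)%E.
Proof.
elim: N f => [|N IH] f mf f0; first by rewrite /= integral_pow0.
rewrite integral_powS//=; apply: eq_integral => x _; apply: IH => //.
apply: (measurableT_comp mf).
exact: (measurableT_comp measurable_scons (measurable_pair1 x)).
Qed.

(** Powers of a measure are symmetric: by induction coordinate [i] is brought just behind the head,
    and Tonelli swaps the two. Any particle can thus be integrated as if it were the first. *)
Lemma integral_pow_move i N (G : T * sq T -> \bar R) : (i <= N)%N ->
  measurable_fun setT G -> (forall z, 0 <= G z)%E ->
  (\int[pow N.+1]_x G (x i, sdel i x) = \int[m]_y \int[pow N]_x G (y, x))%E.
Proof.
elim: i N G => [|i IH] N G iN mG G0.
  rewrite integral_powS//.
  apply: (measurableT_comp mG); apply: measurable_fun_pair => //=.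
      exact: measurable_coord.
    exact: measurable_sdel.
case: N iN => // N iN.
rewrite integral_powS//; last first.
  apply: (measurableT_comp mG); apply: measurable_fun_pair => //=.
    exact: measurable_coord.
  exact: measurable_sdel.
transitivity (\int[m]_x \int[pow N.+1]_y G (y i, scons x (sdel i y)))%E.
  by apply: eq_integral => x _; apply: eq_integral => y _; rewrite sdelS.
have mG3 x : measurable_fun setT (fun z : T * sq T => G (z.1, scons x z.2)).
  apply: (measurableT_comp mG); apply: measurable_fun_pair => //=.
  exact: measurable_scons2.
under eq_integral => x _ do
  rewrite (IH N (fun z : T * sq T => G (z.1, scons x z.2)))//.
have mG4 : measurable_fun setT (fun z : (T * T) * sq T => G (z.1.2, scons z.1.1 z.2)).
  apply: (measurableT_comp mG); apply: measurable_fun_pair => //=.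
    exact: measurableT_comp.
  by apply: measurable_scons2 => //; exact: measurableT_comp.
have mG5 : measurable_fun setT (fun z : T * T => (\int[pow N]_w G (z.2, scons z.1 w))%E).
  apply: (@measurable_fun_fubini_tonelli_F _ _ _ _ _ (pow N)
    (fun z : (T * T) * sq T => G (z.1.2, scons z.1.1 z.2))) => //.
rewrite (fubini_tonelli (fun z : T * T => (\int[pow N]_w G (z.2, scons z.1 w))%E))//; last first.
  by move=> z; exact: integral_ge0.
apply: eq_integral => y _; rewrite integral_powS//.
exact: (measurableT_comp mG (measurable_pair1 y)).
Qed.

End sq_measurable2.

Section ind.
Context d (T : measurableType d) (R : realType).
Local Open Scope ereal_scope.

Definition ind (A : set T) (x : T) : \bar R := (\1_A x)%:E.

Lemma ind_ge0 A x : 0 <= ind A x.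
Proof. by rewrite lee_fin. Qed.

Lemma ind_in A x : A x -> ind A x = 1.
Proof. by move=> Ax; rewrite /ind indicE mem_set. Qed.

Lemma ind_out A x : ~ A x -> ind A x = 0.
Proof. by move=> Ax; rewrite /ind indicE memNset. Qed.

Lemma ind_le1 A x : ind A x <= 1.
Proof. by rewrite lee_fin. Qed.

Lemma measurable_ind A : measurable A -> measurable_fun setT (ind A).
Proof. by move=> mA; apply/measurable_EFinP; exact: measurable_indic. Qed.

Lemma ind_mule_ge0 A x y : 0 <= y -> 0 <= ind A x * y.
Proof. by move=> y0; rewrite mule_ge0// ind_ge0. Qed.

Lemma ind_mule_le A x y z : (A x -> y <= z) -> 0 <= z ->
  ind A x * y <= ind A x * z.
Proof.
move=> yz z0; have [Ax|Ax] := pselect (A x); last by rewrite ind_out// !mul0e.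
by rewrite ind_in// !mul1e; exact: yz.
Qed.

Lemma integral_ind (m : {measure set T -> \bar R}) A : measurable A ->
  \int[m]_x ind A x = m A.
Proof. by move=> mA; rewrite integral_indic// setIT. Qed.

End ind.
Arguments ind {d T R} A x.
Arguments ind_in {d T R A x} _.
Arguments ind_out {d T R A x} _.

#[global] Hint Resolve ind_ge0 : core.

Lemma measurable_set_forall d (X : measurableType d) (P : nat -> set X) :
  (forall i, measurable (P i)) -> measurable [set x | forall i, P i x].
Proof.
move=> mP; rewrite (_ : [set _ | _] = \bigcap_i P i).
  by apply: bigcap_measurableType.
by apply/seteqP; split => x h i => [_|]; [exact: h|exact: (h i I)].
Qed.

Lemma measurable_set_imply d (X : measurableType d) (Q : Prop) (P : set X) :
  measurable P -> measurable [set x | Q -> P x].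
Proof.
move=> mP; have [q|nq] := pselect Q.
  by rewrite (_ : [set _ | _] = P)//; apply/seteqP; split => x /=; auto.
by rewrite (_ : [set _ | _] = setT)//; apply/seteqP; split => x // _ /nq.
Qed.

Lemma measurable_preimage d d' (X : measurableType d) (Y : measurableType d')
    (f : X -> Y) (A : set Y) :
  measurable_fun setT f -> measurable A -> measurable (f @^-1` A).
Proof. by move=> mf mA; rewrite -[X in measurable X]setTI; exact: mf. Qed.

(** * The hard-core gas over an abstract measure space *)

Section gibbs.
Context d (E : measurableType d) (R : realType).
Variables (mu : {sigma_finite_measure set E -> \bar R}) (e0 : E).
Variables (S : set E) (far : set (E * E)) (lam : R).
Hypotheses (mS : measurable S) (mfar : measurable far).
Hypothesis (farC : forall x y, far (x, y) -> far (y, x)).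
Hypothesis (lam0 : 0 < lam).
Local Open Scope ereal_scope.

Local Notation pow := (pow mu e0).

Definition admissible (t : nat) : set (sq E) :=
  [set x | (forall i, (i < t)%N -> S (x i)) /\
    (forall i j, (i < t)%N -> (j < t)%N -> i <> j -> far (x i, x j))].

Definition insertable (t : nat) : set (E * sq E) :=
  [set z | S z.1 /\ forall i, (i < t)%N -> far (z.1, z.2 i)].

Lemma measurable_admissible t : measurable (admissible t).
Proof.
apply: measurableI.
  apply: measurable_set_forall => i; apply: measurable_set_imply.
  exact: (measurable_preimage (@measurable_coord _ E i)).
do 2 (apply: measurable_set_forall => ?).
do 3 apply: measurable_set_imply.
apply: (@measurable_preimage _ _ _ _ (fun x : sq E => (x _, x _))) => //.
by apply: measurable_fun_pair; exact: measurable_coord.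
Qed.

Lemma measurable_insertable t : measurable (insertable t).
Proof.
apply: measurableI.
  exact: (@measurable_preimage _ _ (E * sq E)%type E fst).
apply: measurable_set_forall => i; apply: measurable_set_imply.
apply: (@measurable_preimage _ _ _ _ (fun z : E * sq E => (z.1, z.2 i))) => //.
apply: measurable_fun_pair => //.
exact: (measurableT_comp (@measurable_coord _ E i)).
Qed.

(** The constraints are pairwise, so those involving the entry [i] split off; [farC] recovers the
    pairs in which [i] comes second. *)
Lemma admissible_del t i x : (i <= t)%N ->
  admissible t.+1 x <-> admissible t (sdel i x) /\ insertable t (x i, sdel i x).
Proof.
move=> it; rewrite /admissible /insertable /sdel /=; split.
  move=> [Sx fx]; split; split.
  - by move=> j jt; case: ifP => ji; apply: Sx; rewrite ltnS// ltnW.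
  - move=> j k jt kt jk; do 2 case: ifP => ?; apply: fx; rewrite ?ltnS//; try (by apply/ltnW);
      lia.
  - by apply: Sx.
  - move=> j jt; case: ifP => ji; apply: fx; rewrite ?ltnS//; try (by apply/ltnW); lia.
move=> [[Sx fx] [Si fi]]; split.
- move=> j jt; have [ji|ij|->//] := ltngtP j i.
    by move: (Sx j (leq_trans ji it)); rewrite ji.
  case: j ij jt => // j ij jt.
  by move: (Sx j jt); rewrite ltnNge -ltnS ij.
- have fi' j : (j < t.+1)%N -> j <> i -> far (x i, x j).
    move=> jt ji; have [ji'|ij|//] := ltngtP j i.
      by move: (fi j (leq_trans ji' it)); rewrite ji'.
    case: j ij jt ji => // j ij jt ji.
    by move: (fi j jt); rewrite ltnNge -ltnS ij.
  move=> j k jt kt jk.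
  have [ji|/eqP ji] := eqVneq j i.
    by rewrite ji; apply: fi' => // ki; apply: jk; rewrite ji ki.
  have [ki|/eqP ki] := eqVneq k i.
    by apply: farC; rewrite ki; apply: fi'.
  (* Positions of the entries [j] and [k] of [x] inside [sdel i x]. *)
  pose j' := if (j < i)%N then j else j.-1.
  pose k' := if (k < i)%N then k else k.-1.
  have jE : (if (j' < i)%N then x j' else x j'.+1) = x j.
    rewrite /j'; case: (ltnP j i) => [->//|ij].
    have -> : (j.-1 < i)%N = false by lia.
    by congr (x _); lia.
  have kE : (if (k' < i)%N then x k' else x k'.+1) = x k.
    rewrite /k'; case: (ltnP k i) => [->//|ik].
    have -> : (k.-1 < i)%N = false by lia.
    by congr (x _); lia.
  rewrite -jE -kE; apply: fx; rewrite /j' /k'; case: (ltnP j i) => ?; case: (ltnP k i) => ?; lia.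
Qed.

(* [mnn f]: the function [f] is measurable and nonnegative. *)
Definition mnn d' (X : measurableType d') (f : X -> \bar R) :=
  measurable_fun setT f /\ forall x, 0 <= f x.

Definition wt (t : nat) : R := (lam ^+ t / t`!%:R)%R.

Lemma wt_gt0 t : (0 < wt t)%R.
Proof. by rewrite divr_gt0 ?exprn_gt0// ltr0n fact_gt0. Qed.

(* The hard-core Gibbs weight of an observable: [W (fun _ _ => 1)] is the
   partition function, and [W f / W 1] the expectation of [f]. *)
Definition W (f : nat -> sq E -> \bar R) : \bar R :=
  \sum_(0 <= t <oo) (wt t)%:E * \int[pow t]_x (ind (admissible t) x * f t x).

Lemma mnn_ind d' (X : measurableType d') (A : set X) (f : X -> \bar R) :
  measurable A -> mnn f -> mnn (fun x => ind A x * f x).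
Proof.
move=> mA [mf f0]; split; last by move=> x; exact: ind_mule_ge0.
by apply: emeasurable_funM => //; exact: measurable_ind.
Qed.

Lemma W_term_ge0 t (f : sq E -> \bar R) :
  mnn f -> 0 <= (wt t)%:E * \int[pow t]_x (ind (admissible t) x * f x).
Proof.
move=> mf; rewrite mule_ge0//; first by rewrite lee_fin ltW// wt_gt0.
by apply: integral_ge0 => x _; apply: ind_mule_ge0; exact: mf.2.
Qed.

Lemma W_ge0 f : (forall t, mnn (f t)) -> 0 <= W f.
Proof. by move=> mf; apply: nneseries_ge0 => t _ _; exact: W_term_ge0. Qed.

Lemma W_le f g : (forall t, mnn (f t)) -> (forall t, mnn (g t)) ->
  (forall t x, admissible t x -> f t x <= g t x) -> W f <= W g.
Proof.
move=> mf mg fg; apply: lee_nneseries => [t _ _|t _]; first exact: W_term_ge0.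
apply: lee_wpmul2l; first by rewrite lee_fin ltW// wt_gt0.
have [mf1 mf2] := mnn_ind (measurable_admissible t) (mf t).
have [mg1 mg2] := mnn_ind (measurable_admissible t) (mg t).
apply: ge0_le_integral => // x _; apply: ind_mule_le => // => [h|].
  exact: fg.
exact: (mg t).2.
Qed.

Lemma W_eq f g : (forall t x, admissible t x -> f t x = g t x) -> W f = W g.
Proof.
move=> fg; apply: eq_eseriesr => t _; congr (_ * _); apply: eq_integral => x _.
have [h|h] := pselect (admissible t x); first by rewrite fg.
by rewrite ind_out// !mul0e.
Qed.

Lemma W_add f g : (forall t, mnn (f t)) -> (forall t, mnn (g t)) ->
  W (fun t x => f t x + g t x) = W f + W g.
Proof.
move=> mf mg; rewrite -nneseriesD; [|by move=> t _ _; exact: W_term_ge0..].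
apply: eq_eseriesr => t _.
have [mf1 mf2] := mnn_ind (measurable_admissible t) (mf t).
have [mg1 mg2] := mnn_ind (measurable_admissible t) (mg t).
rewrite -ge0_muleDr; [|by apply: integral_ge0..].
rewrite -ge0_integralD//; congr (_ * _); apply: eq_integral => x _.
by rewrite muleDr//; apply: ge0_adde_def; rewrite inE; [exact: (mf t).2|exact: (mg t).2].
Qed.

Lemma W_scale (c : R) f : (0 <= c)%R -> (forall t, mnn (f t)) ->
  W (fun t x => c%:E * f t x) = c%:E * W f.
Proof.
move=> c0 mf; rewrite -nneseriesZl; last by move=> t _; exact: W_term_ge0.
apply: eq_eseriesr => t _.
have [mf1 mf2] := mnn_ind (measurable_admissible t) (mf t).
rewrite muleCA; congr (_ * _); rewrite -ge0_integralZl//.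
by apply: eq_integral => x _; rewrite muleCA.
Qed.

Lemma W_nneseries (f : nat -> nat -> sq E -> \bar R) : (forall k t, mnn (f k t)) ->
  W (fun t x => \sum_(0 <= k <oo) f k t x) = \sum_(0 <= k <oo) W (f k).
Proof.
move=> mf; rewrite /W -nneseries_interchange; last first.
  by move=> k t; apply: W_term_ge0.
apply: eq_eseriesr => t _.
rewrite nneseriesZl; last first.
  by move=> k _; apply: integral_ge0 => x _; apply: ind_mule_ge0; exact: (mf k t).2.
congr (_ * _); rewrite -integral_nneseries//; first last.
- by move=> k x _; apply: ind_mule_ge0; exact: (mf k t).2.
- by move=> k; exact: (mnn_ind (measurable_admissible t) (mf k t)).1.
apply: eq_integral => x _; rewrite nneseriesZl//.
by move=> k _; exact: (mf k t).2.
Qed.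

Lemma W_integral (f : nat -> E * sq E -> \bar R) : (forall t, mnn (f t)) ->
  \int[mu]_u W (fun t x => f t (u, x)) = W (fun t x => \int[mu]_u f t (u, x)).
Proof.
move=> mf.
have mf2 t : mnn (fun z : E * sq E => ind (admissible t) z.2 * f t z).
  split; last by move=> z; apply: ind_mule_ge0; exact: (mf t).2.
  apply: emeasurable_funM; last exact: (mf t).1.
  by apply: measurableT_comp => //; apply: measurable_ind; exact: measurable_admissible.
rewrite /W integral_nneseries//; last 2 first.
- move=> t; apply: emeasurable_funM => //.
  exact: (measurable_fun_fubini_tonelli_F _ (mf2 t).1 (mf2 t).2).
- move=> t u _; rewrite mule_ge0//; first by rewrite lee_fin ltW// wt_gt0.
  by apply: integral_ge0 => x _; exact: ((mf2 t).2 (u, x)).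
apply: eq_eseriesr => t _.
rewrite ge0_integralZl//; first last.
- by rewrite lee_fin ltW// wt_gt0.
- by move=> u _; apply: integral_ge0 => x _; exact: ((mf2 t).2 (u, x)).
- exact: (measurable_fun_fubini_tonelli_F _ (mf2 t).1 (mf2 t).2).
congr (_ * _).
rewrite (fubini_tonelli _ (mf2 t).1 (mf2 t).2).
apply: eq_integral => x _; rewrite -ge0_integralZl//.
- exact: (measurableT_comp (mf t).1 (measurable_pair2 x)).
- by move=> u _; exact: (mf t).2.
Qed.

Lemma ind_admissible_del t i x : (i <= t)%N ->
  ind (admissible t.+1) x =
  ind (admissible t) (sdel i x) * ind (insertable t) (x i, sdel i x) :> \bar R.
Proof.
move=> it; have [h1 h2] := admissible_del x it.
have [h|h] := pselect (admissible t.+1 x).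
  by have [? ?] := h1 h; rewrite !ind_in// mule1.
rewrite (ind_out h); have [a|a] := pselect (admissible t (sdel i x)); last first.
  by rewrite (ind_out a) mul0e.
rewrite (@ind_out _ _ _ (insertable t) _) ?mule0// => b.
by apply: h; exact: h2.
Qed.

Lemma mnn_sum d' (X : measurableType d') n (f : 'I_n -> X -> \bar R) :
  (forall i, mnn (f i)) -> mnn (fun x => \sum_(i < n) f i x).
Proof.
move=> mf; split; last by move=> x; apply: sume_ge0 => i _; exact: (mf i).2.
by apply: emeasurable_sum => i; exact: (mf i).1.
Qed.

Lemma sume_const n (x : \bar R) : 0 <= x -> \sum_(i < n) x = n%:R%:E * x.
Proof.
move=> x0; elim: n => [|n IH]; first by rewrite big_ord0 mul0e.
by rewrite big_ord_recr/= IH -natr1 EFinD ge0_muleDl ?lee_fin// mul1e.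
Qed.

Lemma mnn_comp d1 d2 (X : measurableType d1) (Y : measurableType d2)
    (f : Y -> \bar R) (g : X -> Y) :
  mnn f -> measurable_fun setT g -> mnn (fun x => f (g x)).
Proof.
by move=> [mf f0] mg; split => [|x]; [exact: (measurableT_comp mf mg)|exact: f0].
Qed.

Lemma mnn_integral d1 d2 (X : measurableType d1) (Y : measurableType d2)
    (m : {sigma_finite_measure set Y -> \bar R}) (f : X * Y -> \bar R) :
  mnn f -> mnn (fun x => \int[m]_y f (x, y)).
Proof.
move=> [mf f0]; split; first exact: (measurable_fun_fubini_tonelli_F _ mf f0).
by move=> x; apply: integral_ge0.
Qed.

Lemma mnn_integral2 d1 d2 (X : measurableType d1) (Y : measurableType d2)
    (m : {sigma_finite_measure set X -> \bar R}) (f : X * Y -> \bar R) :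
  mnn f -> mnn (fun y => \int[m]_x f (x, y)).
Proof.
move=> [mf f0]; split; first exact: (measurable_fun_fubini_tonelli_G _ mf f0).
by move=> x; apply: integral_ge0.
Qed.

Lemma measurable_pick_del i :
  measurable_fun setT (fun x : sq E => (x i, sdel i x)).
Proof.
by apply: measurable_fun_pair; [exact: measurable_coord|exact: measurable_sdel].
Qed.

(** The source of the factor [lam] in [gnz]: the [t.+1] choices of a particle to remove turn the
    factorial of [t.+1] into that of [t]. *)
Lemma wtS t : (wt t.+1 * t.+1%:R = lam * wt t)%R.
Proof.
rewrite /wt exprS factS natrM; field.
by rewrite addrC natr1 !pnatr_eq0/= -lt0n fact_gt0.
Qed.

(* The Georgii-Nguyen-Zessin equation: removing a point from a random configuration
   amounts to inserting one. At [t = 0] the sum is empty and [t.-1] is junk. *)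
Lemma gnz (F : nat -> E * sq E -> \bar R) : (forall t, mnn (F t)) ->
  W (fun t x => \sum_(i < t) F t.-1 (x i, sdel i x)) =
  lam%:E * W (fun t x => \int[mu]_y (ind (insertable t) (y, x) * F t (y, x))).
Proof.
move=> mF.
have mIF t : mnn (fun z => ind (insertable t) z * F t z).
  by apply: mnn_ind => //; exact: measurable_insertable.
rewrite -W_scale; [|exact: ltW|by move=> t; exact: (mnn_integral2 mu (mIF t))].
have mL t : mnn (fun x : sq E => \sum_(i < t) F t.-1 (x i, sdel i x)).
  by apply: mnn_sum => i; apply: mnn_comp => //; exact: measurable_pick_del.
(* The empty configuration has no particle to remove, so the left series starts at one particle and
   is reindexed. *)
rewrite /W nneseries_recl//; last by move=> t _; exact: (W_term_ge0 t (mL t)).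
rewrite [X in X + _](_ : _ = 0) ?add0e; last first.
  by rewrite integral0_eq ?mule0// => x _; rewrite big_ord0 mule0.
rewrite -(nneseries_addn 1)//; last by move=> t; exact: (W_term_ge0 t (mL t)).
apply: eq_eseriesr => t _; rewrite addn1 /=.
have mA : mnn (fun z : E * sq E => ind (admissible t) z.2 * (ind (insertable t) z * F t z)).
  split; last by move=> z; apply: ind_mule_ge0; exact: (mIF t).2.
  apply: emeasurable_funM; last exact: (mIF t).1.
  by apply: measurableT_comp => //; apply: measurable_ind; exact: measurable_admissible.
transitivity ((wt t.+1)%:E * \sum_(i < t.+1) \int[pow t.+1]_x
    (ind (admissible t) (sdel i x) * (ind (insertable t) (x i, sdel i x) * F t (x i, sdel i x)))).
  congr (_ * _); rewrite -ge0_integral_sum//; first last.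
  - move=> i x _; exact: (mA.2 (x i, sdel i x)).
  - move=> i; exact: (mnn_comp mA (measurable_pick_del i)).1.
  apply: eq_integral => x _; rewrite ge0_sume_distrr; last first.
    by move=> i _; exact: (mF t).2.
  by apply: eq_bigr => i _; rewrite (@ind_admissible_del t i)// ?muleA// -ltnS.
(* By symmetry of the power measure the summand no longer depends on [i]. *)
transitivity ((wt t.+1)%:E * \sum_(i < t.+1) \int[mu]_y \int[pow t]_x
    (ind (admissible t) x * (ind (insertable t) (y, x) * F t (y, x)))).
  congr (_ * _); apply: eq_bigr => i _.
  rewrite (integral_pow_move mu e0 (G := fun z => ind (admissible t) z.2 * (ind (insertable t) z * F t z)))//.
  - by rewrite -ltnS.
  - exact: mA.1.
  - exact: mA.2.
rewrite (fubini_tonelli _ mA.1 mA.2) sume_const; last first.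
  by apply: integral_ge0 => x _; apply: integral_ge0 => y _; exact: (mA.2 (y, x)).
rewrite muleA -EFinM wtS mulrC EFinM -muleA; congr (_ * _).
have mI := mnn_integral2 mu (mIF t).
rewrite -ge0_integralZl//; last first.
- by rewrite lee_fin ltW.
- move=> x _; apply: integral_ge0 => y _; exact: (mA.2 (y, x)).
- exact: (mnn_integral2 mu mA).1.
apply: eq_integral => x _; rewrite [RHS]muleCA; congr (_ * _).
rewrite -ge0_integralZl//; last first.
  by move=> y _; exact: (mIF t).2.
exact: (measurableT_comp (mIF t).1 (measurable_pair2 x)).
Qed.

End gibbs.

Section mnn_theory.
Context d (X : measurableType d) (R : realType).
Local Open Scope ereal_scope.

Lemma mnn_mul (f g : X -> \bar R) : mnn f -> mnn g -> mnn (fun x => f x * g x).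
Proof.
move=> [mf f0] [mg g0]; split; first exact: emeasurable_funM.
by move=> x; rewrite mule_ge0.
Qed.

Lemma mnn_indicator (A : set X) : measurable A -> mnn (ind A : X -> \bar R).
Proof. by move=> mA; split => [|x]; [exact: measurable_ind|exact: ind_ge0]. Qed.

Lemma mnn_add (f g : X -> \bar R) : mnn f -> mnn g -> mnn (fun x => f x + g x).
Proof.
move=> [mf f0] [mg g0]; split; first exact: emeasurable_funD.
by move=> x; rewrite adde_ge0.
Qed.

Lemma mnn_cst (c : \bar R) : 0 <= c -> mnn (fun _ : X => c).
Proof. by move=> c0; split. Qed.

Lemma mnn_EFin (f : X -> R) : measurable_fun setT f -> (forall x, 0 <= f x)%R ->
  mnn (fun x => (f x)%:E).
Proof.
by move=> mf f0; split => [|x]; [exact/measurable_EFinP|rewrite lee_fin].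
Qed.

Lemma ge0_integral_le (m : {measure set X -> \bar R}) (f g : X -> \bar R) :
  mnn f -> mnn g -> (forall x, f x <= g x) -> \int[m]_x f x <= \int[m]_x g x.
Proof. by move=> [mf f0] [mg g0] fg; apply: ge0_le_integral. Qed.

End mnn_theory.

(** * Poisson domination around a fixed center *)

Section local_count.
Context d (E : measurableType d) (R : realType).
Variables (mu : {sigma_finite_measure set E -> \bar R}) (e0 : E).
Variables (S : set E) (far : set (E * E)) (lam : R).
Hypotheses (mS : measurable S) (mfar : measurable far).
Hypothesis (farC : forall x y, far (x, y) -> far (y, x)).
Hypothesis (lam0 : 0 < lam).
Hypothesis (Sfin : (mu S < +oo)%E).
Variable u : E.
Local Open Scope ereal_scope.

Local Notation W := (W mu e0 S far lam).
Local Notation insertable := (insertable S far).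
Local Notation near := (~` far).

Definition count_near (t : nat) (x : sq E) : \bar R :=
  \sum_(i < t) ind near (u, x i).

(* Positions near [u] where a particle fits, once the particles near [u] are ignored. *)
Definition shell (t : nat) : set (E * sq E) :=
  [set z | S z.1 /\ near (u, z.1) /\
    forall i, (i < t)%N -> near (u, z.2 i) \/ far (z.1, z.2 i)].

Lemma measurable_near : measurable near.
Proof. exact: measurableC. Qed.

Lemma measurable_pairl : measurable_fun setT (fun y : E => (u, y)).
Proof. by apply: measurable_fun_pair. Qed.

Lemma mnn_near1 : mnn (fun y => ind near (u, y) : \bar R).
Proof.
by apply: mnn_comp; [apply: mnn_indicator; exact: measurable_near|exact: measurable_pairl].
Qed.

Lemma mnn_count_near t : mnn (count_near t).
Proof.
apply: mnn_sum => i; apply: (mnn_comp mnn_near1); exact: measurable_coord.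
Qed.

Lemma measurable_shell t : measurable (shell t).
Proof.
apply: measurableI.
  exact: (@measurable_preimage _ _ (E * sq E)%type E fst).
apply: measurableI.
  apply: (@measurable_preimage _ _ (E * sq E)%type _ (fun z => (u, z.1)) near).
    by apply: measurable_fun_pair.
  exact: measurable_near.
apply: measurable_set_forall => i; apply: measurable_set_imply.
apply: measurableU.
  apply: (@measurable_preimage _ _ (E * sq E)%type _ (fun z => (u, z.2 i)) near).
    apply: measurable_fun_pair => //.
    exact: (measurableT_comp (@measurable_coord _ E i)).
  exact: measurable_near.
apply: (@measurable_preimage _ _ (E * sq E)%type _ (fun z => (z.1, z.2 i)) far) => //.
apply: measurable_fun_pair => //.
exact: (measurableT_comp (@measurable_coord _ E i)).
Qed.

Definition shell_vol (t : nat) (x : sq E) : \bar R := \int[mu]_y ind (shell t) (y, x).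

Lemma mnn_shell t : mnn (ind (shell t) : _ -> \bar R).
Proof. by apply: mnn_indicator; exact: measurable_shell. Qed.

Lemma mnn_shell_vol t : mnn (shell_vol t).
Proof. exact: mnn_integral2 (mnn_shell t). Qed.

Lemma mnn_insertable t : mnn (ind (insertable t) : _ -> \bar R).
Proof. by apply: mnn_indicator; exact: measurable_insertable. Qed.

Lemma mnn_sect d1 d2 (X : measurableType d1) (Y : measurableType d2)
  (f : X * Y -> \bar R) y : mnn f -> mnn (fun x => f (x, y)).
Proof. by move=> mf; apply: (mnn_comp mf); exact: measurable_pair2. Qed.

Lemma shell_vol_le t x : shell_vol t x <= mu S.
Proof.
rewrite -(integral_ind mu mS); apply: ge0_integral_le => //.
- exact: mnn_sect (mnn_shell t).
- exact: mnn_indicator.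
move=> y; have [[Sy _]|h] := pselect (shell t (y, x)).
  by rewrite (ind_in Sy) ind_le1.
by rewrite ind_out.
Qed.

Lemma shell_vol_fin t x : shell_vol t x \is a fin_num.
Proof.
rewrite ge0_fin_numE; last exact: (mnn_shell_vol t).2.
exact: le_lt_trans (shell_vol_le t x) Sfin.
Qed.

(** Real-valued because it is an argument of [expR]; the finite volume of [S] ensures that [fine]
    loses nothing. *)
Definition shell_volr t x : R := (lam * fine (shell_vol t x))%R.

Lemma shell_volrE t x : (shell_volr t x)%:E = lam%:E * shell_vol t x.
Proof. by rewrite /shell_volr EFinM fineK// shell_vol_fin. Qed.

Lemma measurable_shell_volr t : measurable_fun setT (shell_volr t).
Proof.
apply: measurable_funM => //; apply: measurableT_comp => //.
exact: (mnn_shell_vol t).1.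
Qed.

Lemma shell_volr_ge0 t x : (0 <= shell_volr t x)%R.
Proof. by rewrite mulr_ge0 ?(ltW lam0)// fine_ge0//; exact: (mnn_shell_vol t).2. Qed.

(** The disjunct [near (u, z.2 i)] of [shell] voids every constraint coming from a particle near
    [u], so deleting one changes nothing. *)
Lemma shell_del t i x y : (i <= t)%N -> near (u, x i) ->
  shell t.+1 (y, x) <-> shell t (y, sdel i x).
Proof.
move=> it nui; split => -[Sy [nuy h]]; split => //; split => //= j jt.
  by rewrite /sdel; case: ifP => ji; apply: h; rewrite /= ltnS// ltnW.
have [ji|ij|->//] := ltngtP j i.
- by move: (h j (leq_trans ji it)); rewrite /sdel/= ji.
- case: j ij jt => // j ij jt.
  by move: (h j jt); rewrite /sdel/= ltnNge -ltnS ij.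
- by left.
Qed.

Lemma ind_shell_del t i x y : (i <= t)%N -> near (u, x i) ->
  ind (shell t.+1) (y, x) = ind (shell t) (y, sdel i x) :> \bar R.
Proof.
move=> it nui; have [h1 h2] := shell_del y it nui.
have [h|h] := pselect (shell t.+1 (y, x)); first by rewrite !ind_in//; exact: h1.
by rewrite !ind_out// => /h2.
Qed.

Lemma shell_vol_del t i x : (i <= t)%N -> near (u, x i) ->
  shell_vol t.+1 x = shell_vol t (sdel i x).
Proof.
by move=> it nui; apply: eq_integral => y _; exact: ind_shell_del.
Qed.

Lemma count_near_del t i x : (i <= t)%N ->
  count_near t.+1 x = ind near (u, x i) + count_near t (sdel i x).
Proof.
move=> it; rewrite /count_near (bigD1_ord (Ordinal (it : (i < t.+1)%N)))//=.
congr (_ + _); apply: eq_bigr => j _; rewrite /sdel /= /bump.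
by rewrite leqNgt; case: ifP => _.
Qed.

Lemma count_near_nat t x : exists k, count_near t x = k%:R%:E.
Proof.
elim: t => [|t [k kE]]; first by exists 0%N; rewrite /count_near big_ord0.
rewrite /count_near big_ord_recr/= -/(count_near t x) kE.
have [h|h] := pselect (near (u, x t)); [exists k.+1|exists k].
  by rewrite ind_in// -natr1.
by rewrite ind_out// adde0.
Qed.

Definition count_is (t k : nat) : set (sq E) := count_near t @^-1` [set k%:R%:E].

Lemma measurable_count_is t k : measurable (count_is t k).
Proof.
apply: measurable_preimage; first exact: (mnn_count_near t).1.
exact: emeasurable_set1.
Qed.

(** The inequality behind the Poisson domination: a free position avoids every particle, a position
    of the shell only those far from [u]. The repulsion between particles near [u] is given up
    here. *)
Lemma ind_le_insertable t x y :
  ind (insertable t) (y, x) * ind near (u, y) <= ind (shell t) (y, x) :> \bar R.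
Proof.
have [h|h] := pselect (shell t (y, x)); first by rewrite (ind_in h) -[leRHS]mule1 lee_pmul ?ind_le1 ?ind_ge0.
have [h2|h2] := pselect (insertable t (y, x)); last by rewrite (ind_out h2) mul0e ind_ge0.
have [h3|h3] := pselect (near (u, y)); last by rewrite (ind_out h3) mule0 ind_ge0.
exfalso; apply: h; split; first exact: h2.1; split => // i it; right; exact: h2.2.
Qed.

(* [shell_volr] does not see the particles near [u], so that [gnz] applied to the
   removal of one of them leaves [g (shell_volr t x)] unchanged. *)
Lemma count_step k (g : R -> R) : measurable_fun setT g -> (forall z, 0 <= z -> 0 <= g z)%R ->
  k.+1%:R%:E * W (fun t x => ind (count_is t k.+1) x * (g (shell_volr t x))%:E) <=
  W (fun t x => ind (count_is t k) x * (shell_volr t x * g (shell_volr t x))%:E).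
Proof.
move=> mg g0.
have mgv t : mnn (fun x => (g (shell_volr t x))%:E).
  apply: mnn_EFin => [|x]; last by apply: g0; exact: shell_volr_ge0.
  apply: measurableT_comp => //; exact: measurable_shell_volr.
have mC t j := mnn_indicator R (measurable_count_is t j).
have mCg t j := mnn_mul (mC t j) (mgv t).
(* Weight of removing a particle near [u] that leaves [k] others near [u]. A configuration with
   [k.+1] of them admits [k.+1] such removals, whence the factor on the left. *)
pose F t (z : E * sq E) := ind near (u, z.1) * (ind (count_is t k) z.2 * (g (shell_volr t z.2))%:E).
have mF t : mnn (F t).
  apply: mnn_mul; first exact: (mnn_comp mnn_near1 measurable_fst).
  exact: (mnn_comp (mCg t k) measurable_snd).
rewrite -W_scale//.
have -> : W (fun t x => k.+1%:R%:E * (ind (count_is t k.+1) x * (g (shell_volr t x))%:E)) =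
    W (fun t x => \sum_(i < t) F t.-1 (x i, sdel i x)).
  apply: W_eq => -[|t] x _.
    rewrite big_ord0 ind_out ?mul0e ?mule0// /count_is /= /count_near big_ord0 => -[].
    by apply/eqP; rewrite eq_sym pnatr_eq0.
  transitivity (count_near t.+1 x * (ind (count_is t.+1 k.+1) x * (g (shell_volr t.+1 x))%:E)).
    have [h|h] := pselect (count_is t.+1 k.+1 x); last by rewrite ind_out// !mul0e !mule0.
    by rewrite /count_is /= in h; rewrite h.
  rewrite muleC ge0_sume_distrr; last by move=> i _; exact: ind_ge0.
  apply: eq_bigr => i _; rewrite /F /=.
  have it : (i <= t)%N by rewrite -ltnS.
  have [h|h] := pselect (near (u, x i)); last by rewrite (ind_out h) mul0e mule0.
  rewrite muleC; congr (_ * (_ * _)); last first.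
    by rewrite /shell_volr (shell_vol_del it h).
  have cE := count_near_del x it.
  have [h1|h1] := pselect (count_is t k (sdel i x)).
    rewrite !ind_in// /count_is /= cE ind_in//.
    by rewrite /count_is /= in h1; rewrite h1 -EFinD nat1r.
  rewrite !ind_out// => h2; apply: h1; move: h2; rewrite /count_is /= cE ind_in//.
  have [j ->] := count_near_nat t (sdel i x).
  by rewrite -EFinD nat1r => -[] /eqP; rewrite eqr_nat => /eqP[->].
rewrite gnz//.
have mI t : mnn (fun x => \int[mu]_y (ind (insertable t) (y, x) * F t (y, x))).
  apply: (@mnn_integral2 _ _ _ _ _ mu (fun z => ind (insertable t) z * F t z)).
  by apply: mnn_mul => //; exact: mnn_insertable.
have mz t : mnn (fun x => ind (count_is t k) x * (shell_volr t x * g (shell_volr t x))%:E).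
  apply: mnn_mul => //; apply: mnn_EFin.
    apply: measurable_funM; first exact: measurable_shell_volr.
    by apply: measurableT_comp => //; exact: measurable_shell_volr.
  by move=> x; rewrite mulr_ge0 ?shell_volr_ge0// g0// shell_volr_ge0.
rewrite -W_scale//; [|exact: ltW].
apply: W_le => // t.
  by apply: mnn_mul => //; apply: mnn_cst; rewrite lee_fin ltW.
move=> x _.
rewrite EFinM shell_volrE muleCA -muleA; apply: lee_wpmul2l; first by rewrite lee_fin ltW.
rewrite /shell_vol -ge0_integralZr//; last 2 first.
- exact: (mnn_sect x (mnn_shell t)).1.
- exact: (mCg t k).2.
apply: ge0_integral_le => [||y].
- apply: (mnn_sect x (f := fun z => ind (insertable t) z * F t z)).
  by apply: mnn_mul => //; exact: mnn_insertable.
- apply: mnn_mul; first exact: (mnn_sect x (mnn_shell t)).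
  by apply: mnn_cst; exact: (mCg t k).2.
rewrite /F /= muleA; apply: lee_wpmul2r; first exact: (mCg t k).2.
exact: ind_le_insertable.
Qed.

Lemma mnn_count_shell t k (g : R -> R) :
  measurable_fun setT g -> (forall z, 0 <= z -> 0 <= g z)%R ->
  mnn (fun x => ind (count_is t k) x * (g (shell_volr t x))%:E).
Proof.
move=> mg g0; apply: mnn_mul; first exact: (mnn_indicator R (measurable_count_is t k)).
apply: mnn_EFin => [|x]; last by apply: g0; exact: shell_volr_ge0.
apply: measurableT_comp => //; exact: measurable_shell_volr.
Qed.

(** Poisson weights up to the factorial. The factor [z] produced by [count_step] moves [j] to
    [j.+1]. *)
Let gexp (j : nat) (z : R) : R := (z ^+ j * expR (- z))%R.

Let measurable_gexp j : measurable_fun setT (gexp j).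
Proof.
apply: measurable_funM; first exact: measurable_funX.
by apply: measurableT_comp => //; exact: measurable_expR.
Qed.

Let gexp_ge0 j z : (0 <= z -> 0 <= gexp j z)%R.
Proof. by move=> z0; rewrite mulr_ge0 ?exprn_ge0// expR_ge0. Qed.

(** Each use of [count_step] removes one particle near [u] and gains one factor [shell_volr]. The
    exponent [j] is left free so that the induction on [k] can shift it. *)
Lemma count_iter k j :
  k`!%:R%:E * W (fun t x => ind (count_is t k) x * (gexp j (shell_volr t x))%:E) <=
  W (fun t x => ind (count_is t 0) x * (gexp (j + k) (shell_volr t x))%:E).
Proof.
elim: k j => [|k IH] j; first by rewrite fact0 mul1e addn0.
rewrite factS mulnC natrM EFinM -muleA.
apply: (@le_trans _ _ (k`!%:R%:E * W (fun t x => ind (count_is t k) x * (gexp j.+1 (shell_volr t x))%:E))).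
  apply: lee_wpmul2l; first by rewrite lee_fin.
  apply: (le_trans (count_step k (measurable_gexp j) (gexp_ge0 j))).
  by rewrite le_eqVlt; apply/orP; left; apply/eqP; apply: W_eq => t x _;
    rewrite /gexp exprS mulrA.
by rewrite -addSnnS; exact: IH.
Qed.

Lemma sum_exp_coeff (z : R) :
  \sum_(0 <= k <oo) (k`!%:R^-1 * z ^+ k)%:E = (expR z)%:E.
Proof.
rewrite /expR -EFin_lim; last exact: is_cvg_series_exp_coeff.
congr (limn _); apply/funext => n; rewrite /= /series/= -sumEFin.
by apply: eq_bigr => k _; rewrite /exp_coeff mulrC.
Qed.

(* Conditionally on the particles far from [u], the number of particles near [u] is
   dominated by a Poisson variable of parameter [shell_volr]. *)
Lemma poisson_void :
  W (fun t x => (expR (- shell_volr t x))%:E) <= W (fun t x => ind (count_is t 0) x).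
Proof.
have mb k j t := mnn_count_shell t k (measurable_gexp j) (@gexp_ge0 j).
have mf k t : mnn (fun x => (k`!%:R^-1)%:E * (ind (count_is t 0) x * (gexp k (shell_volr t x))%:E)).
  by apply: mnn_mul => //; apply: mnn_cst; rewrite lee_fin.
have ms (f : nat -> nat -> sq E -> \bar R) : (forall k t, mnn (f k t)) ->
    forall t, mnn (fun x => \sum_(0 <= k <oo) f k t x).
  move=> hf t; split; last by move=> x; apply: nneseries_ge0 => k _ _; exact: (hf k t).2.
  by apply: ge0_emeasurable_sum => k; [move=> x _ _; exact: (hf k t).2|move=> _; exact: (hf k t).1].
(* Split according to the number of particles near [u]; for each configuration the term of its own
   count suffices. *)
apply: (@le_trans _ _ (W (fun t x => \sum_(0 <= k <oo) (ind (count_is t k) x * (gexp 0 (shell_volr t x))%:E)))).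
  apply: W_le => // [t||t x _].
  - apply: mnn_EFin => [|x]; last exact: expR_ge0.
    apply: measurableT_comp => //; apply: measurableT_comp => //; exact: measurable_shell_volr.
  - by apply: ms => k t.
  have [k kE] := count_near_nat t x.
  apply: le_trans (nneseries_lim_ge k.+1 _) => /=; last by move=> ? _ _; exact: (mb _ _ _).2.
  rewrite big_nat_recr//= (_ : ind (count_is t k) x = 1) ?mul1e; last exact: ind_in.
  rewrite {2}/gexp expr0 mul1r leeDr// sume_ge0// => i _.
  exact: (mb _ _ _).2.
rewrite W_nneseries//.
(* [count_iter] at [j = 0] reduces every count to a void. *)
apply: (@le_trans _ _ (\sum_(0 <= k <oo) W (fun t x => (k`!%:R^-1)%:E * (ind (count_is t 0) x * (gexp k (shell_volr t x))%:E)))).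
  apply: lee_nneseries => [k _ _|k _]; first exact: W_ge0.
  rewrite W_scale// -[leLHS]mul1e.
  have -> : 1 = ((k`!%:R^-1)%:E * k`!%:R%:E : \bar R).
    by rewrite -EFinM mulVf// pnatr_eq0 -lt0n fact_gt0.
  rewrite -muleA; apply: lee_wpmul2l; first by rewrite lee_fin.
  exact: (count_iter k 0).
(* On a void, with [v] the value of [shell_volr], the exponential series of [v] cancels
   [expR (- v)]. *)
rewrite -W_nneseries//; apply: W_le => //.
- exact: ms.
- by move=> t; exact: mnn_indicator (measurable_count_is t 0).
move=> t x _.
have [h|h] := pselect (count_is t 0 x); last first.
  by rewrite eseries0// => k _ _; rewrite (ind_out h) mul0e mule0.
rewrite (ind_in h) le_eqVlt; apply/orP; left; apply/eqP.
transitivity (\sum_(0 <= k <oo) ((expR (- shell_volr t x))%:E * (k`!%:R^-1 * (shell_volr t x) ^+ k)%:E)).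
  by apply: eq_eseriesr => k _; rewrite mul1e -!EFinM /gexp; congr (_%:E); ring.
rewrite nneseriesZl; last first.
  by move=> k _; rewrite lee_fin mulr_ge0// exprn_ge0// shell_volr_ge0.
by rewrite sum_exp_coeff -EFinM -expRD addNr expR0.
Qed.

End local_count.

(** * First moment of the free volume near a center *)

Section density.
Context d (E : measurableType d) (R : realType).
Variables (mu : {sigma_finite_measure set E -> \bar R}) (e0 : E).
Variables (S : set E) (far : set (E * E)) (lam : R).
Hypotheses (mS : measurable S) (mfar : measurable far).
Hypothesis (farC : forall x y, far (x, y) -> far (y, x)).
Hypothesis (lam0 : 0 < lam).
Hypothesis (Sfin : (mu S < +oo)%E).
Local Open Scope ereal_scope.

Local Notation W := (W mu e0 S far lam).
Local Notation insertable := (insertable S far).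
Local Notation near := (~` far).

Lemma mnn_W (f : nat -> E * sq E -> \bar R) : (forall t, mnn (f t)) ->
  mnn (fun u => W (fun t x => f t (u, x))).
Proof.
move=> mf; split; last first.
  by move=> u; apply: W_ge0 => // t; apply: (mnn_comp (mf t)); exact: measurable_pair1.
have mg t : mnn (fun u => \int[pow mu e0 t]_x (ind (admissible S far t) x * f t (u, x))).
  apply: (mnn_integral _ (f := fun z : E * sq E => ind (admissible S far t) z.2 * f t z)).
  apply: mnn_mul => //; apply: (mnn_comp _ measurable_snd).
  by apply: mnn_indicator; exact: measurable_admissible.
apply: ge0_emeasurable_sum => t.
  by move=> u _ _; rewrite mule_ge0//; [rewrite lee_fin ltW// wt_gt0|exact: (mg t).2].
by move=> _; apply: emeasurable_funM => //; exact: (mg t).1.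
Qed.

(** Used twice: for the finiteness of the partition function and for the volume of a cube. *)
Lemma integral_pow_box t :
  \int[pow mu e0 t]_x ind [set x : sq E | forall i, (i < t)%N -> S (x i)] x =
  ((fine (mu S)) ^+ t)%:E.
Proof.
have mbox n : measurable [set x : sq E | forall i, (i < n)%N -> S (x i)].
  apply: measurable_set_forall => i; apply: measurable_set_imply.
  exact: (measurable_preimage (@measurable_coord _ E i)).
elim: t => [|t IH]; first by rewrite integral_pow0 ?ind_in//; exact: measurable_ind.
rewrite integral_powS//; last exact: measurable_ind.
transitivity (\int[mu]_x (ind S x * (fine (mu S) ^+ t)%:E)).
  apply: eq_integral => x _; rewrite -IH -ge0_integralZl//; last exact: measurable_ind.
  apply: eq_integral => y _.
  have [Sx|Sx] := pselect (S x); last first.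
    by rewrite (ind_out Sx) mul0e ind_out// => /(_ 0%N isT).
  rewrite (ind_in Sx) mul1e.
  have [h|h] := pselect (forall i, (i < t)%N -> S (y i)).
    by rewrite !ind_in// => -[|i]//= it; exact: h.
  by rewrite !ind_out// => h2; apply: h => i it; exact: (h2 i.+1).
rewrite ge0_integralZr//; [|exact: measurable_ind|by rewrite lee_fin exprn_ge0// fine_ge0].
by rewrite integral_ind// exprS EFinM fineK// ge0_fin_numE.
Qed.

(** Without the exclusion the series is that of an ideal gas, an exponential. *)
Lemma W1_fin : W (fun _ _ => 1) < +oo.
Proof.
apply: (@le_lt_trans _ _ (expR (lam * fine (mu S)))%:E); last by rewrite ltry.
rewrite -sum_exp_coeff; apply: lee_nneseries => [t _ _|t _].
  apply: W_term_ge0 => //; exact: mnn_cst.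
rewrite /wt exprMn mulrA [X in _ <= (X * _)%:E]mulrC EFinM; apply: lee_wpmul2l.
  by rewrite lee_fin divr_ge0// exprn_ge0// ltW.
rewrite -integral_pow_box; apply: ge0_integral_le.
- apply: mnn_mul; last exact: mnn_cst.
  by apply: mnn_indicator; exact: measurable_admissible.
- apply: mnn_indicator; apply: measurable_set_forall => i; apply: measurable_set_imply.
  exact: (measurable_preimage (@measurable_coord _ E i)).
move=> x; rewrite mule1.
have [h|h] := pselect (forall i, (i < t)%N -> S (x i)).
  by rewrite [leRHS]ind_in// ind_le1.
by rewrite !ind_out// => -[].
Qed.

Lemma W_count : W (fun t _ => t%:R%:E) =
  lam%:E * W (fun t x => \int[mu]_y ind (insertable t) (y, x)).
Proof.
have := gnz mu e0 mS mfar farC lam0 (F := fun _ _ => 1) (fun _ => mnn_cst _ lee01).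
under [X in W X]eq_fun do under eq_fun do rewrite sume_const// mule1.
have -> : W (fun t x => \int[mu]_y (ind (insertable t) (y, x) * 1)) =
    W (fun t x => \int[mu]_y ind (insertable t) (y, x)).
  by apply: W_eq => t x _; apply: eq_integral => y _; rewrite mule1.
by [].
Qed.

Section fixed_center.
Variable u : E.

Local Notation count_near := (count_near R far u).
Local Notation shell_vol := (shell_vol mu S far u).
Local Notation shell_volr := (shell_volr mu S far lam u).
Local Notation shell := (shell S far u).

Lemma W_count_near : W count_near =
  lam%:E * W (fun t x => \int[mu]_y (ind (insertable t) (y, x) * ind near (u, y))).
Proof.
pose F (t : nat) (z : E * sq E) := ind near (u, z.1) : \bar R.
have mF t : mnn (F t) by exact: (mnn_comp (mnn_near1 R mfar u) measurable_fst).
exact: (gnz mu e0 mS mfar farC lam0 mF).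
Qed.

(** Finiteness is what allows [first_moment], where this quantity occurs on both sides, to be solved
    for it. *)
Lemma W_shell_fin : W (fun t x => (shell_volr t x)%:E) < +oo.
Proof.
apply: (@le_lt_trans _ _ (W (fun t x => (lam * fine (mu S))%:E * 1))).
  apply: W_le => //.
  - move=> t; apply: mnn_EFin; first exact: measurable_shell_volr.
    by move=> x; exact: shell_volr_ge0.
  - move=> t; apply: mnn_mul; apply: mnn_cst => //.
    by rewrite lee_fin mulr_ge0 ?(ltW lam0)// fine_ge0.
  move=> t x _; rewrite mule1 shell_volrE// EFinM; apply: lee_wpmul2l.
    by rewrite lee_fin ltW.
  by rewrite fineK ?ge0_fin_numE//; exact: shell_vol_le.
rewrite W_scale//; last by rewrite mulr_ge0 ?(ltW lam0)// fine_ge0.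
  by rewrite lte_mul_pinfty ?W1_fin// lee_fin mulr_ge0 ?(ltW lam0)// fine_ge0.
Qed.

Variable kappa : R.
Hypothesis kappa0 : (0 <= kappa)%R.
Hypothesis geo : forall A : set E, measurable A -> A `<=` [set y | near (u, y)] ->
  mu A < +oo ->
  \int[mu]_y (ind A y * \int[mu]_z (ind A z * ind near (y, z))) <= kappa%:E * mu A.

(** The blocked part of the shell is charged to the particles near [u] that block it. By [gnz] the
    sum over these becomes an integral over insertable positions near [u], which lie in the shell
    themselves, so that [geo] applies with the shell as [A]. *)
Lemma first_moment :
  W (fun t x => (shell_volr t x)%:E) <=
  W count_near + (lam * kappa)%:E * W (fun t x => (shell_volr t x)%:E).
Proof.
have mnear : mnn (ind near : _ -> \bar R) by apply: mnn_indicator; exact: measurable_near.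
have msh t := mnn_shell R mS mfar u t.
have mins t := mnn_insertable R mS mfar t.
have mv t : mnn (fun x => (shell_volr t x)%:E).
  apply: mnn_EFin; first exact: measurable_shell_volr.
  by move=> x; exact: shell_volr_ge0.
pose G t (z : (E * sq E) * E) : \bar R := ind (shell t) (z.2, z.1.2) * ind near (z.1.1, z.2).
have mG t : mnn (G t).
  apply: mnn_mul.
    apply: (mnn_comp (msh t)); apply: measurable_fun_pair => //.
    by apply: measurableT_comp.
  apply: (mnn_comp mnear); apply: measurable_fun_pair => //.
  by apply: measurableT_comp.
(* Volume of the shell blocked by a particle near [u]. The shell is computed from the other
   particles, the form that [gnz] requires; by [shell_del] it is the same shell. *)
pose F t (z : E * sq E) := ind near (u, z.1) * \int[mu]_y G t (z, y).
have mF t : mnn (F t).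
  apply: mnn_mul; first exact: (mnn_comp (mnn_near1 R mfar u) measurable_fst).
  exact: (mnn_integral mu (mG t)).
pose fr t (x : sq E) := \int[mu]_y (ind (insertable t) (y, x) * ind near (u, y)).
have mfr0 t : mnn (fun z : E * sq E => ind (insertable t) z * ind near (u, z.1) : \bar R).
  have mnu : mnn (fun z : E * sq E => ind near (u, z.1) : \bar R).
    exact: (mnn_comp (mnn_near1 R mfar u) measurable_fst).
  exact: (mnn_mul (mins t) mnu).
have mfr t : mnn (fr t) by exact: mnn_integral2 (mfr0 t).
have mFs t : mnn (fun x : sq E => \sum_(i < t) F t.-1 (x i, sdel i x)).
  by apply: mnn_sum => i; apply: (mnn_comp (mF t.-1)); exact: measurable_pick_del.
(* A free position of the shell is counted in [fr]; one that is not is blocked by some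
   particle [x i] near [u]. *)
have step1 t x : shell_vol t x <= fr t x + \sum_(i < t) F t.-1 (x i, sdel i x).
  have mterm i : mnn (fun y => ind near (u, x i) * G t.-1 ((x i, sdel i x), y)).
    apply: mnn_mul; first exact: mnn_cst.
    by apply: (mnn_comp (mG t.-1)); exact: measurable_pair1.
  have -> : \sum_(i < t) F t.-1 (x i, sdel i x) =
      \int[mu]_y \sum_(i < t) (ind near (u, x i) * G t.-1 ((x i, sdel i x), y)).
    rewrite ge0_integral_sum//; [|by move=> i; exact: (mterm i).1|by move=> i y _; exact: (mterm i).2].
    apply: eq_bigr => i _; rewrite ge0_integralZl//; last by move=> y _; exact: (mG _).2.
    by apply: (measurableT_comp (mG t.-1).1); exact: measurable_pair1.
  have mi1 := mnn_sect x (mfr0 t).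
  have mi2 : mnn (fun y => \sum_(i < t) (ind near (u, x i) * G t.-1 ((x i, sdel i x), y))).
    by apply: mnn_sum => i; exact: mterm.
  rewrite /fr -ge0_integralD//; [|by move=> *; exact: mi1.2|exact: mi1.1|by move=> *; exact: mi2.2|exact: mi2.1].
  apply: ge0_integral_le; [exact: mnn_sect (msh t)|exact: mnn_add|move=> y].
  have [h|h] := pselect (shell t (y, x)); last first.
    by rewrite (ind_out h) adde_ge0//; [exact: mi1.2|exact: mi2.2].
  rewrite (ind_in h); have [hi|hi] := pselect (insertable t (y, x)).
    rewrite (ind_in hi) mul1e (ind_in h.2.1) leeDl//; exact: mi2.2.
  have [i [it nyi]] : exists i, (i < t)%N /\ near (y, x i).
    apply: contrapT => hh; apply: hi; split; first exact: h.1.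
    by move=> i it; apply: contrapT => fyi; apply: hh; exists i.
  have nui : near (u, x i) by have [//|] := h.2.2 i it.
  rewrite (bigD1 (Ordinal it))//=; apply: le_trans (leeDr _ (mi1.2 y)).
  case: t it h {mfr0 mFs mterm mi1 mi2 hi fr mfr} => // t it h.
  rewrite (ind_in nui) mul1e /G /=.
  have h' := (shell_del S y (it : (i <= t)%N) nui).1 h.
  rewrite (ind_in h') mul1e (@ind_in _ _ _ near (x i, y)).
    rewrite leeDl// sume_ge0// => j _; do 2?apply: mule_ge0; exact: ind_ge0.
  by move=> /farC.
have step2 t x : admissible S far t x ->
    \int[mu]_y (ind (insertable t) (y, x) * F t (y, x)) <= kappa%:E * shell_vol t x.
  move=> _; pose A := [set y | shell t (y, x)].
  have mA : measurable A.
    by apply: (measurable_preimage (f := fun y => (y, x))) (measurable_shell mS mfar u t); exact: measurable_pair2.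
  have muA : shell_vol t x = mu A by rewrite -integral_ind.
  rewrite muA; apply: le_trans (geo mA _ _).
  - apply: ge0_integral_le => [||y].
    + apply: (mnn_sect x (f := fun z => ind (insertable t) z * F t z)); exact: mnn_mul.
    + apply: mnn_mul; first exact: mnn_indicator.
      apply: (mnn_integral mu (f := fun z : E * E => ind A z.2 * ind near z)).
      apply: mnn_mul => //; apply: (mnn_comp (mnn_indicator R mA)); exact: measurable_snd.
    rewrite /F muleA; apply: lee_pmul => //.
    + apply: mule_ge0; exact: ind_ge0.
    + by apply: integral_ge0 => z _; exact: (mG t).2.
    + exact: ind_le_insertable.
  - by move=> y [_ []].
  - rewrite -muA; apply: le_lt_trans Sfin; exact: shell_vol_le.
have mIF t : mnn (fun x => \int[mu]_y (ind (insertable t) (y, x) * F t (y, x))).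
  apply: (@mnn_integral2 _ _ _ _ _ mu (fun z => ind (insertable t) z * F t z)).
  exact: mnn_mul.
have msv t := mnn_shell_vol mu mS mfar u t.
have WvE : W (fun t x => (shell_volr t x)%:E) = lam%:E * W shell_vol.
  rewrite -W_scale//; [|exact: ltW].
  by apply: W_eq => t x _; rewrite shell_volrE.
rewrite W_count_near WvE.
apply: (@le_trans _ _ (lam%:E * W (fun t x => fr t x + \sum_(i < t) F t.-1 (x i, sdel i x)))).
  apply: lee_wpmul2l; first by rewrite lee_fin ltW.
  by apply: W_le => // t; exact: mnn_add.
rewrite W_add// ge0_muleDr ?W_ge0//; apply: leeD2l.
rewrite (gnz mu e0 mS mfar farC lam0 mF) EFinM -[leRHS]muleA.
apply: lee_wpmul2l; first by rewrite lee_fin ltW.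
rewrite [leRHS]muleCA; apply: lee_wpmul2l; first by rewrite lee_fin ltW.
rewrite -W_scale//; apply: W_le => // t; apply: mnn_mul => //; exact: mnn_cst.
Qed.

End fixed_center.

End density.

(* Unification would otherwise unfold the series. *)
Opaque W.

(** * From void probabilities to a density bound *)

Section void.
Context d (E : measurableType d) (R : realType).
Variables (mu : {sigma_finite_measure set E -> \bar R}) (e0 : E).
Variables (S : set E) (far : set (E * E)) (lam : R).
Hypotheses (mS : measurable S) (mfar : measurable far).
Hypothesis (farC : forall x y, far (x, y) -> far (y, x)).
Hypothesis (lam0 : 0 < lam).
Hypothesis (Sfin : (mu S < +oo)%E).
Local Open Scope ereal_scope.

Local Notation W := (W mu e0 S far lam).
Local Notation insertable := (insertable S far).
Local Notation near := (~` far).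

Section fixed_center.
Variable u : E.

Local Notation count_near := (count_near R far u).
Local Notation shell_volr := (shell_volr mu S far lam u).

Variable kappa : R.
Hypothesis kappa0 : (0 <= kappa)%R.
Hypothesis geo : forall A : set E, measurable A -> A `<=` [set y | near (u, y)] ->
  mu A < +oo ->
  \int[mu]_y (ind A y * \int[mu]_z (ind A z * ind near (y, z))) <= kappa%:E * mu A.

(* Either the neighbourhood of [u] is empty with probability of order at least
   [e^-a (1 + a)], or it contains many particles on average. *)
Lemma void_or_crowded a : (0 <= a)%R -> (lam * kappa < 1)%R ->
  ((1 - lam * kappa) * (expR (- a) * (1 + a)))%:E * W (fun _ _ => 1) <=
  (1 - lam * kappa)%:E * W (fun t x => ind (count_is R far u t 0) x) +
  (expR (- a))%:E * W count_near.
Proof.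
move=> a0 lk1.
have mv t : mnn (fun x => (shell_volr t x)%:E).
  apply: mnn_EFin; first exact: measurable_shell_volr.
  by move=> x; exact: shell_volr_ge0.
have me t : mnn (fun x => (expR (- shell_volr t x))%:E).
  apply: mnn_EFin => [|x]; last exact: expR_ge0.
  apply: measurableT_comp => //; apply: measurableT_comp => //; exact: measurable_shell_volr.
have m1 (t : nat) : mnn (fun _ : sq E => 1 : \bar R) by exact: mnn_cst.
(* Tangent line of [expR] at [a]: [e^-z >= e^-a (1 + a - z)]. *)
have tangent : (expR (- a) * (1 + a))%:E * W (fun _ _ => 1) <=
    W (fun t x => ind (count_is R far u t 0) x) +
    (expR (- a))%:E * W (fun t x => (shell_volr t x)%:E).
  apply: le_trans (leeD2r _ (poisson_void e0 mS mfar farC lam0 Sfin u)).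
  rewrite -!W_scale//; last by rewrite mulr_ge0 ?expR_ge0// addr_ge0.
  rewrite -W_add//; last first.
    by move=> t; apply: mnn_mul => //; apply: mnn_cst; rewrite lee_fin expR_ge0.
  apply: W_le => // [t|t|t x _].
  - by apply: mnn_mul; apply: mnn_cst => //; rewrite lee_fin mulr_ge0 ?expR_ge0// addr_ge0.
  - apply: mnn_add => //; apply: mnn_mul => //; apply: mnn_cst; rewrite lee_fin expR_ge0//.
  rewrite mule1 -EFinM -EFinD lee_fin.
  set z := shell_volr t x.
  have : (expR (- a) * (1 + (a - z)) <= expR (- a) * expR (a - z))%R.
    by rewrite ler_wpM2l ?expR_ge0// expR_ge1Dx.
  rewrite -expRD addKr; set p := expR (- a); set q := expR (- z); lra.
have fm := first_moment e0 mS mfar farC lam0 Sfin kappa0 geo.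
have Wvfin : W (fun t x => (shell_volr t x)%:E) \is a fin_num.
  by rewrite ge0_fin_numE ?W_shell_fin// W_ge0.
have lk0 : (0 <= 1 - lam * kappa)%R by rewrite subr_ge0 ltW.
move: fm tangent; rewrite -(fineK Wvfin); set v := fine _ => fm tangent.
have fm2 : ((1 - lam * kappa) * v)%:E <= W count_near.
  rewrite mulrBl mul1r EFinB leeBlDr//.
rewrite EFinM -muleA.
apply: le_trans (lee_wpmul2l _ tangent) _; first by rewrite lee_fin.
rewrite ge0_muleDr//.
- apply: leeD2l; rewrite muleCA; apply: lee_wpmul2l; first by rewrite lee_fin expR_ge0.
  by rewrite -EFinM.
- by apply: W_ge0 => // t; apply: mnn_indicator; exact: measurable_count_is.
- rewrite mule_ge0 ?lee_fin ?expR_ge0// fine_ge0//; by apply: W_ge0.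
Qed.

End fixed_center.

(** A void at a point of [S] is room for a particle there; integrated over [u], it becomes a
    multiple of the particle number by [W_count]. *)
Lemma ind_void u t x :
  ind S u * ind (count_is R far u t 0) x = ind (insertable t) (u, x) :> \bar R.
Proof.
have [Su|Su] := pselect (S u); last first.
  by rewrite (ind_out Su) mul0e ind_out// => -[].
rewrite (ind_in Su) mul1e.
have [h|h] := pselect (insertable t (u, x)).
  rewrite !ind_in// /count_is/= /count_near big1// => i _.
  by rewrite ind_out// => /(_ (h.2 i (ltn_ord i))).
rewrite [RHS]ind_out// ind_out// => h2; apply: h; split => // i it.
apply: contrapT => fui.
move: h2; rewrite /count_is/= /count_near (bigD1 (Ordinal it))//=.
rewrite (@ind_in _ _ _ near (u, x i))// => /eqP; apply/negP.
rewrite gt_eqF//; apply: (@lt_le_trans _ _ 1) => //; rewrite leeDl// sume_ge0// => j _.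
exact: ind_ge0.
Qed.

Variables (kappa V0 a : R).
Hypotheses (kappa0 : (0 <= kappa)%R) (V00 : (0 <= V0)%R) (lk1 : (lam * kappa < 1)%R) (a0 : (0 <= a)%R).
Hypothesis geo : forall u, S u -> forall A : set E, measurable A ->
  A `<=` [set y | near (u, y)] -> mu A < +oo ->
  \int[mu]_y (ind A y * \int[mu]_z (ind A z * ind near (y, z))) <= kappa%:E * mu A.
Hypothesis near_vol : forall y, S y -> mu [set z | near (z, y)] <= V0%:E.

(** In the crowded term the order of counting is exchanged: a particle of [S] is near centers of
    total volume at most [V0]. Restricting the centers to [S] only lowers that count, so no boundary
    correction appears. *)
Lemma hard_core_density :
  ((1 - lam * kappa) * (expR (- a) * (1 + a)))%:E * (mu S * W (fun _ _ => 1)) <=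
  ((1 - lam * kappa) / lam + expR (- a) * V0)%:E * W (fun t _ => t%:R%:E).
Proof.
have lk0 : (0 <= 1 - lam * kappa)%R by rewrite subr_ge0 ltW.
have mnear : mnn (ind near : _ -> \bar R) by apply: mnn_indicator; exact: measurable_near.
have mSi : mnn (ind S : _ -> \bar R) by exact: mnn_indicator.
have m1 (t : nat) : mnn (fun _ : sq E => 1 : \bar R) by exact: mnn_cst.
have W1 : 0 <= W (fun _ _ => 1) by exact: W_ge0.
have mcount t : mnn (fun _ : sq E => t%:R%:E : \bar R).
  by apply: mnn_cst; rewrite lee_fin.
have mN0 t : mnn (fun z : E * sq E => \sum_(i < t) ind near (z.1, z.2 i) : \bar R).
  apply: mnn_sum => i; apply: (mnn_comp mnear); apply: measurable_fun_pair => //.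
  exact: (measurableT_comp (@measurable_coord _ E i)).
have mN t : mnn (fun z : E * sq E => ind S z.1 * \sum_(i < t) ind near (z.1, z.2 i) : \bar R).
  by apply: mnn_mul => //; exact: (mnn_comp mSi measurable_fst).
have mI t := mnn_insertable R mS mfar t.
have cntE u : S u -> W (count_near R far u) =
    W (fun t x => ind S u * \sum_(i < t) ind near (u, x i)).
  by move=> Su; apply: W_eq => t x _; rewrite (ind_in Su) mul1e.
have voidE u : S u -> W (fun t x => ind (count_is R far u t 0) x) =
    W (fun t x => ind (insertable t) (u, x)).
  by move=> Su; apply: W_eq => t x _; rewrite -ind_void (ind_in Su) mul1e.
have mWI := mnn_W mu e0 mS mfar lam0 mI.
have mWN := mnn_W mu e0 mS mfar lam0 mN.
have mNs t : mnn (fun x : sq E => \int[mu]_u (ind S u * \sum_(i < t) ind near (u, x i))).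
  exact: mnn_integral2 (mN t).
have mIs t : mnn (fun x : sq E => \int[mu]_u ind (insertable t) (u, x)).
  exact: mnn_integral2 (mI t).
set C := (_ * (_ * _))%R.
have C0 : (0 <= C)%R by rewrite mulr_ge0// mulr_ge0 ?expR_ge0// addr_ge0.
have main : C%:E * (mu S * W (fun _ _ => 1)) <=
   (1 - lam * kappa)%:E * \int[mu]_u W (fun t x => ind (insertable t) (u, x)) +
   (expR (- a))%:E * \int[mu]_u W (fun t x => ind S u * \sum_(i < t) ind near (u, x i)).
  rewrite -ge0_integralZl//; [|exact: mWI.1|by move=> u _; exact: mWI.2].
  rewrite -ge0_integralZl//; [|exact: mWN.1|by move=> u _; exact: mWN.2].
  have mt1 : mnn (fun u => (1 - lam * kappa)%:E * W (fun t x => ind (insertable t) (u, x))).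
    by apply: mnn_mul => //; apply: mnn_cst; rewrite lee_fin.
  have mt2 : mnn (fun u => (expR (- a))%:E * W (fun t x => ind S u * \sum_(i < t) ind near (u, x i))).
    by apply: mnn_mul => //; apply: mnn_cst; rewrite lee_fin expR_ge0.
  rewrite -ge0_integralD//; [|by move=> u _; exact: mt1.2|exact: mt1.1|by move=> u _; exact: mt2.2|exact: mt2.1].
  rewrite -(integral_ind mu mS) muleCA -ge0_integralZr//; [|exact: mSi.1|by rewrite mule_ge0].
  apply: ge0_integral_le => [||u].
  - by apply: mnn_mul => //; apply: mnn_cst; rewrite mule_ge0.
  - exact: mnn_add.
  have [Su|Su] := pselect (S u); last first.
    rewrite [X in X * _ <= _](ind_out Su) [leLHS]mul0e.
    by apply: adde_ge0; [exact: mt1.2|exact: mt2.2].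
  rewrite [X in X * _ <= _](ind_in Su) [leLHS]mul1e.
  have := void_or_crowded kappa0 (geo Su) a0 lk1.
  by rewrite (voidE _ Su) (cntE _ Su).
apply: le_trans main _.
have := W_integral mu e0 mS mfar lam0 mI.
rewrite /= => ->.
have := W_integral mu e0 mS mfar lam0 mN.
rewrite /= => ->.
have WA : W (fun t x => \int[mu]_u ind (insertable t) (u, x)) =
    (lam^-1)%:E * W (fun t _ => t%:R%:E).
  rewrite (W_count mu e0 mS mfar farC lam0) [RHS]muleA -EFinM mulVf ?gt_eqF//.
  by rewrite [RHS]mul1e.
have WN : W (fun t x => \int[mu]_u (ind S u * \sum_(i < t) ind near (u, x i))) <=
    V0%:E * W (fun t _ => t%:R%:E).
  rewrite -W_scale//; apply: W_le => // [t|t x [Sx _]].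
    by apply: mnn_mul => //; exact: mnn_cst.
  have mx i : mnn (fun u => ind near (u, x i) : \bar R).
    by apply: (mnn_comp mnear); exact: measurable_pair2.
  have mxs : mnn (fun u => \sum_(i < t) ind near (u, x i) : \bar R) by exact: mnn_sum.
  apply: (@le_trans _ _ (\int[mu]_u \sum_(i < t) ind near (u, x i))).
    apply: ge0_integral_le => // [|u]; first exact: mnn_mul.
    by rewrite -[leRHS]mul1e lee_pmul// ?ind_ge0 ?ind_le1//; exact: mxs.2.
  rewrite ge0_integral_sum//; last by move=> i; exact: (mx i).1.
  rewrite [leRHS]muleC -sume_const ?lee_fin//; apply: lee_sum => i _.
  have mnx : measurable [set z | near (z, x i)].
    apply: (@measurable_preimage _ _ _ _ (fun z => (z, x i)) near).
      exact: measurable_pair2.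
    exact: measurable_near.
  apply: le_trans (near_vol (Sx i (ltn_ord i))).
  by rewrite -(integral_ind mu mnx).
have WA0 : 0 <= W (fun t _ => t%:R%:E) by exact: W_ge0.
rewrite WA [X in _ <= X * _]EFinD [leRHS]ge0_muleDl; first last.
- by rewrite lee_fin mulr_ge0// expR_ge0.
- by rewrite lee_fin divr_ge0// ltW.
apply: leeD.
  by rewrite [leLHS]muleA -EFinM.
by rewrite [X in _ <= X * _]EFinM -[leRHS]muleA; apply: lee_wpmul2l => //; rewrite lee_fin expR_ge0.
Qed.

End void.

(** * Convexity of the log-partition function *)

Section power_series.
Context (R : realType) (c : nat -> \bar R).
Hypothesis c0 : forall t, (0 <= c t)%E.
Local Open Scope ereal_scope.

(** For [c] the sequence of the [Zhat], this is [Zpart] by conversion. *)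
Definition gfun (l : R) : \bar R := \sum_(0 <= t <oo) (l ^+ t)%:E * c t.
(* [l] times the derivative of [gfun]. *)
Definition gfun1 (l : R) : \bar R := \sum_(0 <= t <oo) (t%:R * l ^+ t)%:E * c t.

Lemma gfun_ge0 l : (0 <= l)%R -> 0 <= gfun l.
Proof.
by move=> l0; apply: nneseries_ge0 => t _ _; rewrite mule_ge0// lee_fin exprn_ge0.
Qed.

Lemma gfun1_ge0 l : (0 <= l)%R -> 0 <= gfun1 l.
Proof.
by move=> l0; apply: nneseries_ge0 => t _ _; rewrite mule_ge0// lee_fin mulr_ge0// exprn_ge0.
Qed.

(** Jensen for the weights [l ^+ t * c t]: the tangent of [expR] at the mean [h * m] of [h * t] is
    summed over [t], and the choice of [m] cancels the linear terms. Thus [m] is a subgradient of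
    [log Z] in the variable [log l]. *)
Lemma gfun_convex l h : (0 < l)%R -> (0 <= h)%R ->
  gfun l < +oo -> (0 < fine (gfun l))%R -> gfun1 l < +oo -> gfun (l * expR h) < +oo ->
  (expR (h * (fine (gfun1 l) / fine (gfun l))) * fine (gfun l) <=
   fine (gfun (l * expR h)))%R.
Proof.
move=> l0 h0 Zoo Z0 Aoo Zhoo.
set m := (_ / _)%R.
have l0' := ltW l0.
have lh0 : (0 <= l * expR h)%R by rewrite mulr_ge0 ?expR_ge0.
have ZE : (fine (gfun l))%:E = gfun l by rewrite fineK// ge0_fin_numE// gfun_ge0.
have AE : (fine (gfun1 l))%:E = gfun1 l by rewrite fineK// ge0_fin_numE// gfun1_ge0.
have ZhE : (fine (gfun (l * expR h)))%:E = gfun (l * expR h).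
  by rewrite fineK// ge0_fin_numE// gfun_ge0.
have m0 : (0 <= m)%R by apply: divr_ge0; apply: fine_ge0; [exact: gfun1_ge0|exact: gfun_ge0].
have lt0 t : (0 <= l ^+ t)%R by rewrite exprn_ge0.
have G (a : R) (b : \bar R) : (0 <= a)%R -> 0 <= b -> 0 <= a%:E * b.
  by move=> a0 b0; rewrite mule_ge0.
(* The negative term of the tangent is moved to the right, so that all series have nonnegative
   terms. *)
have main : (expR (h * m))%:E * gfun l + (expR (h * m) * h)%:E * gfun1 l <=
    gfun (l * expR h) + (expR (h * m) * (h * m))%:E * gfun l.
  rewrite /gfun /gfun1 -!nneseriesZl; [|by move=> t _; do ?[by []|exact: exprn_ge0|apply: (G)|apply: mulr_ge0]..].
  rewrite -!nneseriesD; first last.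
  - by move=> t _ _; do ?[by []|exact: expR_ge0|exact: exprn_ge0|apply: (G)|apply: mulr_ge0].
  - by move=> t _ _; do ?[by []|exact: expR_ge0|exact: exprn_ge0|apply: (G)|apply: mulr_ge0].
  - by move=> t _ _; do ?[by []|exact: expR_ge0|exact: exprn_ge0|apply: (G)|apply: mulr_ge0].
  - by move=> t _ _; do ?[by []|exact: expR_ge0|exact: exprn_ge0|apply: (G)|apply: mulr_ge0].
  apply: lee_nneseries => [t _ _|t _].
    by apply: adde_ge0; do ?[by []|exact: expR_ge0|exact: exprn_ge0|apply: (G)|apply: mulr_ge0].
  rewrite !muleA -!EFinM -!ge0_muleDl ; do ?[by []|exact: expR_ge0|exact: exprn_ge0|rewrite lee_fin|apply: mulr_ge0].
  apply: lee_wpmul2r => //; rewrite -!EFinD lee_fin.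
  have : (expR (h * m) * (1 + (h * t%:R - h * m)) <= expR (h * m) * expR (h * t%:R - h * m))%R.
    by rewrite ler_wpM2l ?expR_ge0// expR_ge1Dx.
  rewrite -expRD (_ : h * m + (h * t%:R - h * m) = h * t%:R)%R; last by ring.
  rewrite exprMn -expRM_natr.
  set E1 := expR (h * m); set E2 := expR (h * t%:R) => H.
  have := ler_wpM2l (lt0 t) H; lra.
move: main; rewrite -ZE -AE -ZhE -!EFinM -!EFinD lee_fin.
have mE : (m * fine (gfun l) = fine (gfun1 l))%R by rewrite /m divfK// gt_eqF.
rewrite -mE; lra.
Qed.

End power_series.

(** A left Riemann sum of the subgradient [al] on [J] equal steps [h]: the slopes [K * h * j] for
    [j < J] bring in [J * (J - 1) / 2], whence the factor [1 - 1 / J]. *)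
Lemma riemann_lower (R : realType) (f al : R -> R) (K s0 s1 : R) (J : nat) :
  (0 < J)%N -> s0 <= s1 -> 0 <= K ->
  0 <= f s0 ->
  (forall s h, s0 <= s -> 0 <= h -> s + h <= s1 -> f s + h * al s <= f (s + h)) ->
  (forall s, s0 <= s <= s1 -> K * (s - s0) <= al s) ->
  K * (1 - J%:R^-1) * ((s1 - s0) ^+ 2 / 2) <= f s1.
Proof.
move=> J0 s01 K0 fs0 step alK.
have JR : 0 < J%:R :> R by rewrite ltr0n.
set h := (s1 - s0) / J%:R.
have h0 : 0 <= h by rewrite divr_ge0// ?subr_ge0// ltW.
have hJ : h * J%:R = s1 - s0 by rewrite divfK// gt_eqF.
have H j : (j <= J)%N -> K * h ^+ 2 * (j%:R * (j%:R - 1) / 2) <= f (s0 + j%:R * h).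
  elim: j => [|j IH] jJ; first by rewrite !mul0r mulr0 addr0.
  have jh : 0 <= j%:R * h by rewrite mulr_ge0.
  have jJ' : s0 + j%:R * h + h <= s1.
    have : h * (j%:R + 1) <= h * J%:R by rewrite ler_wpM2l// natr1 ler_nat.
    rewrite hJ; lra.
  have a1 : K * (s0 + j%:R * h - s0) <= al (s0 + j%:R * h) by apply: alK; lra.
  have s1' : f (s0 + j%:R * h) + h * al (s0 + j%:R * h) <= f (s0 + j%:R * h + h).
    by apply: step => //; lra.
  have -> : s0 + j.+1%:R * h = s0 + j%:R * h + h by rewrite -natr1; lra.
  apply: le_trans s1'.
  have IH' := IH (ltnW jJ).
  have := ler_wpM2l h0 a1.
  rewrite -natr1; nra.
have := H J (leqnn J).
have -> : s0 + J%:R * h = s1 by rewrite mulrC hJ; lra.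
apply: le_trans; rewrite -hJ le_eqVlt; apply/orP; left; apply/eqP.
by field; rewrite gt_eqF.
Qed.

(** * Uniform convexity for a single block *)

Section powr_convexity.
Context (R : realType) (p : R).
Hypothesis p12 : 1 < p <= 2.

Let p1 : 1 < p. Proof. by case/andP: p12. Qed.
Let p2 : p <= 2. Proof. by case/andP: p12. Qed.
Let p0 : 0 < p. Proof. exact: lt_trans p1. Qed.

(** Young's inequality for [x] and [1], with exponents [p] and [p / (p - 1)]. *)
Lemma powR_bernoulli (x : R) : 0 <= x -> 1 + p * (x - 1) <= x `^ p.
Proof.
move=> x0; have pm1 : 0 < p - 1 by rewrite subr_gt0.
have := @conjugate_powR R x 1 p (p / (p - 1)) x0 ler01 p0 (divr_gt0 p0 pm1).
rewrite powR1 mulr1 invf_div => /(_ _)/wrap[].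
  by field; rewrite gt_eqF.
rewrite mul1r => H.
have := ler_wpM2l (ltW p0) H.
rewrite mulrDr [p * (x `^ p / p)]mulrC divfK ?gt_eqF//.
rewrite [p * ((p - 1) / p)]mulrC divfK ?gt_eqF//; lra.
Qed.

(* The denominator is [2 * 9]: [powR_bernoulli2] squares Bernoulli's inequality at
   [Num.sqrt (1 + t)] and uses [t <= 3 * (Num.sqrt (1 + t) - 1)]. *)
Definition cvx_const : R := p * (p - 1) / 18.

Lemma cvx_const_gt0 : 0 < cvx_const.
Proof. by rewrite divr_gt0// mulr_gt0// subr_gt0. Qed.

Lemma cvx_const_le : cvx_const <= 1 / 9.
Proof. rewrite /cvx_const; have := p1; have := p2; nra. Qed.

Lemma powR_bernoulli2 (t : R) : 0 <= t <= 1 ->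
  1 + p * t + 2 * cvx_const * t ^+ 2 <= (1 + t) `^ p.
Proof.
move=> /andP[t0 t1].
set y := Num.sqrt (1 + t).
have y0 : 0 <= y by exact: sqrtr_ge0.
have y2 : y ^+ 2 = 1 + t by rewrite sqr_sqrtr// addr_ge0.
have y1 : 1 <= y by rewrite -(@ler_sqr _ 1 y) ?nnegrE// y2; lra.
have y3 : y <= 2 by rewrite -(@ler_sqr _ y 2) ?nnegrE// y2; lra.
have ty : t <= 3 * (y - 1) by nra.
have By := powR_bernoulli y0.
have -> : (1 + t) `^ p = (y `^ p) ^+ 2.
  by rewrite -y2 expr2 powRM// -expr2.
have B0 : 0 <= 1 + p * (y - 1) by have := p0; nra.
have B2 : (1 + p * (y - 1)) ^+ 2 <= (y `^ p) ^+ 2.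
  by rewrite ler_sqr ?nnegrE// powR_ge0.
apply: le_trans B2.
have te : t = y ^+ 2 - 1 by rewrite y2; lra.
have t2 : t ^+ 2 <= 9 * (y - 1) ^+ 2 by nra.
have c2 : 2 * cvx_const * t ^+ 2 <= p * (p - 1) * (y - 1) ^+ 2.
  have -> : p * (p - 1) * (y - 1) ^+ 2 = 2 * cvx_const * (9 * (y - 1) ^+ 2).
    by rewrite /cvx_const; field.
  by rewrite ler_wpM2l// mulr_ge0// ltW// cvx_const_gt0.
(* Since [t = y ^+ 2 - 1], this middle term is exactly [(1 + p * (y - 1)) ^+ 2]. *)
apply: (@le_trans _ _ (1 + p * t + p * (p - 1) * (y - 1) ^+ 2)); first by rewrite lerD2l.
rewrite te; nra.
Qed.

(** With [x = 1 + t] and [y = 1 - t], the second-order bound serves for the larger number and the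
    tangent line for the smaller; the terms [p * t] cancel. *)
Lemma powR_strict_convex (x y : R) : 0 <= x -> 0 <= y -> x + y = 2 ->
  1 + cvx_const * ((x - y) / 2) ^+ 2 <= (x `^ p + y `^ p) / 2.
Proof.
wlog xy : x y / y <= x.
  move=> W x0 y0 s; have [|/ltW] := leP y x; first by move=> h; exact: W.
  by move=> h; have := W y x h y0 x0; rewrite addrC s [y `^ p + _]addrC => /(_ erefl);
    rewrite -[y - x]opprB mulNr sqrrN.
move=> x0 y0 s; set t := (x - y) / 2.
have xE : x = 1 + t by rewrite /t; lra.
have yE : y = 1 - t by rewrite /t; lra.
have t01 : 0 <= t <= 1 by rewrite /t; apply/andP; split; lra.
have := powR_bernoulli2 t01; rewrite -xE => Hx.
have := powR_bernoulli y0; rewrite {1}yE => Hy.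
lra.
Qed.

(** For [p < 2] no multiple of [g ^+ 2] dominates the power near [0], hence the additive slack [e].
    Below [1] the power is at most [g] and AM-GM applies; above [1] it is at most [g ^+ 2]. *)
Lemma powR_le_quad (g e : R) : 0 <= g -> 0 < e -> e <= 1 / 4 ->
  g `^ p <= e + g ^+ 2 / (4 * e).
Proof.
move=> g0 e0 e4.
have e4' : 0 < 4 * e by rewrite mulr_gt0.
have amgm : g <= e + g ^+ 2 / (4 * e).
  have : g ^+ 2 / (4 * e) * (4 * e) = g ^+ 2 by rewrite divfK// gt_eqF.
  rewrite -(ler_pM2r e4'); set q := g ^+ 2 / (4 * e) => qE.
  have S := sqr_ge0 (g - 2 * e); rewrite [leRHS]mulrDl qE; nra.
have [g1|/ltW g1] := leP g 1.
  have [->|gn0] := eqVneq g 0.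
    by rewrite powR0 ?gt_eqF// expr0n mul0r addr0 ltW.
  apply: le_trans amgm; apply: ge1r_powR; last exact: ltW.
  by rewrite lt_def gn0 g0.
apply: (@le_trans _ _ (g ^+ 2)).
  by rewrite -powR_mulrn//; exact: ler_powR.
rewrite -[leLHS]add0r lerD// ?(ltW e0)//.
rewrite ler_pdivlMr// -[leRHS]mulr1 ler_wpM2l ?sqr_ge0//; lra.
Qed.

(* [A], [B], [C], [M] are the norms of [a], [b], [a - b], [(a + b) / 2] for a pair of
   vectors [a], [b] of a Euclidean space. *)
Lemma block_convex (A B C M e : R) : 0 <= A -> 0 <= B -> 0 <= C -> 0 <= M ->
  4 * M ^+ 2 + C ^+ 2 = 2 * A ^+ 2 + 2 * B ^+ 2 -> M <= (A + B) / 2 ->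
  0 < e -> e <= 1 / 4 ->
  C `^ p <= e * ((A `^ p + B `^ p) / 2) +
    (e * cvx_const)^-1 * ((A `^ p + B `^ p) / 2 - M `^ p).
Proof.
move=> A0 B0 C0 M0 par tri e0 e4.
(* Both sides are homogeneous of degree [p]: the mean of [A] and [B] is normalized to [1], apart
   from the degenerate case where everything vanishes. *)
set m := (A + B) / 2.
have m0 : 0 <= m by rewrite divr_ge0// addr_ge0.
have [mz|mn0] := eqVneq m 0.
  have Az : A = 0 by rewrite /m in mz; lra.
  have Bz : B = 0 by rewrite /m in mz; lra.
  have Mz : M = 0 by apply/eqP; rewrite eq_le M0 andbT; apply: le_trans tri _; rewrite -/m mz.
  have Cz : C = 0.
    by apply/eqP; rewrite -sqrf_eq0; apply/eqP; move: par; rewrite Az Bz Mz; lra.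
  by rewrite Az Bz Cz Mz powR0 ?gt_eqF//; lra.
have mp : 0 < m by rewrite lt_def mn0 m0.
pose x := A / m; pose y := B / m; pose g := C / m; pose n := M / m.
have AE : A = x * m by rewrite /x divfK.
have BE : B = y * m by rewrite /y divfK.
have CE : C = g * m by rewrite /g divfK.
have ME : M = n * m by rewrite /n divfK.
have x0 : 0 <= x by rewrite divr_ge0.
have y0 : 0 <= y by rewrite divr_ge0.
have g0 : 0 <= g by rewrite divr_ge0.
have n0 : 0 <= n by rewrite divr_ge0.
have s : x + y = 2 by rewrite /x /y -mulrDl /m; field; rewrite /m in mn0; apply: contra_neq mn0 => ->; rewrite mul0r.
have n1 : n <= 1 by rewrite /n ler_pdivrMr// mul1r.
have npar : 4 * n ^+ 2 + g ^+ 2 = 2 * x ^+ 2 + 2 * y ^+ 2.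
  apply: (mulIf (x := m ^+ 2)); first by rewrite expf_neq0.
  by move: par; rewrite AE BE CE ME; lra.
have Ap : A `^ p = x `^ p * m `^ p by rewrite [in LHS]AE powRM.
have Bp : B `^ p = y `^ p * m `^ p by rewrite [in LHS]BE powRM.
have Cp : C `^ p = g `^ p * m `^ p by rewrite [in LHS]CE powRM.
have Mp : M `^ p = n `^ p * m `^ p by rewrite [in LHS]ME powRM.
rewrite Ap Bp Cp Mp.
have mpp : 0 < m `^ p by exact: powR_gt0.
have -> : e * ((x `^ p * m `^ p + y `^ p * m `^ p) / 2) +
   (e * cvx_const)^-1 * ((x `^ p * m `^ p + y `^ p * m `^ p) / 2 - n `^ p * m `^ p) =
   (e * ((x `^ p + y `^ p) / 2) +
   (e * cvx_const)^-1 * ((x `^ p + y `^ p) / 2 - n `^ p)) * m `^ p.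
  by set u := (e * _)^-1; ring.
rewrite ler_pM2r//.
have hx := powR_strict_convex x0 y0 s.
set h := (x `^ p + y `^ p) / 2 in hx *.
set t := (x - y) / 2 in hx.
have tE : n ^+ 2 = 1 + t ^+ 2 - g ^+ 2 / 4.
  have -> : t ^+ 2 = (x ^+ 2 + y ^+ 2) / 2 - 1.
    have yx : y = 2 - x by lra.
    by rewrite /t yx; field.
  lra.
have np : n `^ p <= n.
  have [->|nn0] := eqVneq n 0; first by rewrite powR0 ?gt_eqF.
  by apply: ge1r_powR; [rewrite lt_def nn0 n0|exact: ltW].
have nq : n <= (1 + n ^+ 2) / 2 by nra.
have c0 := cvx_const_gt0; have c1 := cvx_const_le.
have n2 : n ^+ 2 <= 1 by nra.
(* By [tE], [g ^+ 2 / 4] equals [t ^+ 2 + (1 - n ^+ 2)]. The inequality of the two norms pays for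
   the first part, through [powR_strict_convex]; the shortness of the midpoint pays for the
   second. *)
have hn : cvx_const * g ^+ 2 / 4 <= h - n `^ p.
  have : cvx_const * (1 - n ^+ 2) <= (1 - n ^+ 2) / 2 by nra.
  rewrite tE in nq *; nra.
have h1 : 1 <= h by apply: le_trans hx; rewrite lerDl mulr_ge0 ?sqr_ge0// ltW.
apply: (le_trans (powR_le_quad g0 e0 e4)).
apply: lerD; first by rewrite -[leLHS]mulr1 ler_wpM2l// ltW.
have -> : g ^+ 2 / (4 * e) = (e * cvx_const)^-1 * (cvx_const * g ^+ 2 / 4).
  by field; rewrite !gt_eqF.
by rewrite ler_wpM2l// invr_ge0 mulr_ge0// ltW.
Qed.

End powr_convexity.

(** * Euclidean blocks and the mixed norm *)

Section block.
Context (R : realType).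
Implicit Types (x y a b : nat -> R) (k : nat -> nat).

Lemma block_norm_ge0 k j x : 0 <= block_norm k j x.
Proof. exact: sqrtr_ge0. Qed.

Lemma sqr_block_norm k j x : block_norm k j x ^+ 2 = \sum_(k j <= i < k j.+1) x i ^+ 2.
Proof. by rewrite sqr_sqrtr// sumr_ge0// => i _; exact: sqr_ge0. Qed.

Lemma block_normZ k j (s : R) x : 0 <= s ->
  block_norm k j (fun i => s * x i) = s * block_norm k j x.
Proof.
move=> s0; rewrite /block_norm -[s in RHS]ger0_norm// -sqrtr_sqr -sqrtrM ?sqr_ge0//.
by congr Num.sqrt; rewrite mulr_sumr; apply: eq_bigr => i _; rewrite exprMn.
Qed.

Lemma block_normN k j x : block_norm k j (fun i => - x i) = block_norm k j x.
Proof. by congr Num.sqrt; apply: eq_bigr => i _; rewrite sqrrN. Qed.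

Lemma eq_block_norm k j x y : (forall i, (i < k j.+1)%N -> x i = y i) ->
  block_norm k j x = block_norm k j y.
Proof.
move=> xy; congr Num.sqrt; rewrite big_nat_cond [RHS]big_nat_cond.
by apply: eq_bigr => i /andP[/andP[_ ik] _]; rewrite xy.
Qed.

Lemma block_parallelogram k j a b :
  4 * block_norm k j (fun i => 2^-1 * (a i + b i)) ^+ 2 +
  block_norm k j (fun i => a i - b i) ^+ 2 =
  2 * block_norm k j a ^+ 2 + 2 * block_norm k j b ^+ 2.
Proof.
rewrite !sqr_block_norm !mulr_sumr -!big_split/=.
by apply: eq_bigr => i _; field.
Qed.

Lemma block_cauchy_schwarz k j a b :
  \sum_(k j <= i < k j.+1) a i * b i <= block_norm k j a * block_norm k j b.
Proof.
set A := block_norm k j a; set B := block_norm k j b; set I := \sum_(_ <= _ < _) _.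
have A0 : 0 <= A by exact: block_norm_ge0.
have B0 : 0 <= B by exact: block_norm_ge0.
have null x : block_norm k j x = 0 -> forall i, (k j <= i < k j.+1)%N -> x i = 0.
  move=> x0 i ik; apply/eqP; rewrite -sqrf_eq0.
  have : \sum_(k j <= i < k j.+1) x i ^+ 2 = 0 by rewrite -sqr_block_norm x0 expr0n.
  rewrite big_nat_cond => /eqP; rewrite psumr_eq0; last by move=> ? _; exact: sqr_ge0.
  by move=> /allP/(_ i); rewrite mem_index_iota ik => /(_ isT)/implyP/(_ isT).
have [Az|An] := eqVneq A 0.
  rewrite Az mul0r /I big_nat_cond big1// => i /andP[ik _].
  by rewrite (null a)// mul0r.
have [Bz|Bn] := eqVneq B 0.
  rewrite Bz mulr0 /I big_nat_cond big1// => i /andP[ik _].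
  by rewrite (null b)// mulr0.
have AB : 0 < A * B by rewrite mulr_gt0// lt_def ?An ?Bn.
have : 0 <= \sum_(k j <= i < k j.+1) (B * a i - A * b i) ^+ 2.
  by rewrite sumr_ge0// => i _; exact: sqr_ge0.
have -> : \sum_(k j <= i < k j.+1) (B * a i - A * b i) ^+ 2 =
    2 * (A * B) * (A * B - I).
  transitivity (B ^+ 2 * (\sum_(k j <= i < k j.+1) a i ^+ 2) +
      A ^+ 2 * (\sum_(k j <= i < k j.+1) b i ^+ 2) - 2 * (A * B) * I); last first.
    by rewrite -!sqr_block_norm -/A -/B; ring.
  rewrite /I !mulr_sumr -big_split/= -sumrB; apply: eq_bigr => i _; ring.
by rewrite pmulr_rge0; [rewrite subr_ge0|rewrite mulr_gt0].
Qed.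

End block.

Section pk.
Context (R : realType) (p : R) (m n : nat) (k : nat -> nat).
Hypothesis p12 : 1 < p <= 2.
Hypotheses (k0 : k 0%N = 0%N) (km : k m = n).
Hypothesis (kinc : forall j, (j < m)%N -> (k j < k j.+1)%N).
Implicit Types (x y a b : nat -> R).

Let p1 : 1 < p. Proof. by case/andP: p12. Qed.
Let p2 : p <= 2. Proof. by case/andP: p12. Qed.
Let p0 : 0 < p. Proof. exact: lt_trans p1. Qed.
Let pn0 : p != 0. Proof. by rewrite gt_eqF. Qed.

Definition pk_sum x : R := \sum_(j < m) block_norm k j x `^ p.

Lemma pk_sum_ge0 x : 0 <= pk_sum x.
Proof. by rewrite sumr_ge0// => j _; exact: powR_ge0. Qed.

Lemma pk_norm_ge0 x : 0 <= pk_norm p m k x.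
Proof. exact: powR_ge0. Qed.

Lemma pk_norm_powR x : pk_norm p m k x `^ p = pk_sum x.
Proof. by rewrite -powRrM mulVf// powRr1// pk_sum_ge0. Qed.

Lemma powR_le_iff (u v : R) : 0 <= u -> 0 <= v -> (u `^ p <= v `^ p) = (u <= v).
Proof.
move=> u0 v0; apply/idP/idP => h.
  rewrite leNgt; apply/negP => vu.
  have := gt0_ltr_powR p0 _ _ vu; rewrite !nnegrE => /(_ v0 u0).
  by rewrite ltNge h.
by apply: ge0_ler_powR => //; exact: ltW.
Qed.

Lemma pk_norm_le x r : 0 <= r -> (pk_norm p m k x <= r) = (pk_sum x <= r `^ p).
Proof. by move=> r0; rewrite -pk_norm_powR powR_le_iff// pk_norm_ge0. Qed.

Lemma kmono i j : (i <= j <= m)%N -> (k i <= k j)%N.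
Proof.
elim: j => [|j IH]; first by rewrite leqn0 => /andP[/eqP->].
case/andP; rewrite leq_eqVlt => /predU1P[->//|ij] jm.
apply: leq_trans (ltnW (kinc jm)); apply: IH.
by rewrite -ltnS ij ltnW.
Qed.

Lemma eq_pk_norm x y : (forall i, (i < n)%N -> x i = y i) ->
  pk_norm p m k x = pk_norm p m k y.
Proof.
move=> xy; congr (_ `^ _); apply: eq_bigr => j _; congr (_ `^ _).
apply: eq_block_norm => i ij; apply: xy; apply: (leq_trans ij).
by rewrite -km; apply: kmono; rewrite ltn_ord leqnn.
Qed.

Lemma pk_normZ s x : 0 <= s -> pk_norm p m k (fun i => s * x i) = s * pk_norm p m k x.
Proof.
move=> s0; rewrite /pk_norm.
under eq_bigr do rewrite block_normZ// powRM ?block_norm_ge0//.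
rewrite -mulr_sumr powRM ?powR_ge0 ?pk_sum_ge0//.
by rewrite -powRrM mulfV// powRr1.
Qed.

Lemma pk_normN x : pk_norm p m k (fun i => - x i) = pk_norm p m k x.
Proof. by congr (_ `^ _); apply: eq_bigr => j _; rewrite block_normN. Qed.

Lemma pk_distC x y : pk_dist p m k x y = pk_dist p m k y x.
Proof.
rewrite /pk_dist -pk_normN; congr (pk_norm _ _ _ _).
by apply/funext => i; rewrite opprB.
Qed.

Lemma coord_le_pk_norm x i : (i < n)%N -> `|x i| <= pk_norm p m k x.
Proof.
move=> ni.
have [j jm /andP[kji ikj]] : exists2 j, (j < m)%N & (k j <= i < k j.+1)%N.
  have : exists j, (i < k j)%N by exists m; rewrite km.
  move=> /ex_minnP[[|j] ij jmin]; first by rewrite k0 in ij.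
  have jm : (j < m)%N by apply: jmin; rewrite km.
  exists j => //; rewrite ij andbT leqNgt; apply/negP => /jmin.
  by rewrite ltnn.
rewrite -powR_le_iff ?pk_norm_ge0// pk_norm_powR.
apply: (@le_trans _ _ (block_norm k j x `^ p)).
  rewrite powR_le_iff ?block_norm_ge0// -ler_sqr ?nnegrE ?block_norm_ge0//.
  rewrite real_normK ?num_real// sqr_block_norm (bigD1_seq i) ?iota_uniq ?mem_index_iota ?kji//=.
  by rewrite lerDl sumr_ge0// => ? _; exact: sqr_ge0.
rewrite /pk_sum (bigD1 (Ordinal jm))//= lerDl sumr_ge0// => ? _; exact: powR_ge0.
Qed.

(** Serves to show that the unit ball has positive volume, so a crude cube will do: its size makes
    every block norm at most [1 / m.+1]. *)
Lemma pk_norm_cube x : (0 < n)%N ->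
  (forall i, (i < n)%N -> `|x i| <= (Num.sqrt n%:R * m.+1%:R)^-1) ->
  pk_norm p m k x <= 1.
Proof.
move=> n0 xle.
rewrite pk_norm_le// powR1 /pk_sum.
have sn0 : 0 < Num.sqrt (n%:R : R) by rewrite sqrtr_gt0 ltr0n.
apply: (@le_trans _ _ (\sum_(j < m) m.+1%:R^-1)); last first.
  rewrite sumr_const card_ord -[leLHS]mulr_natl ler_pdivrMr ?ltr0n// mul1r.
  by rewrite ler_nat.
apply: ler_sum => j _.
have B : block_norm k j x <= m.+1%:R^-1.
  rewrite -ler_sqr ?nnegrE ?block_norm_ge0 ?invr_ge0// sqr_block_norm.
  have knm : (k j.+1 <= n)%N by rewrite -km; apply: kmono; rewrite ltn_ord leqnn.
  apply: (@le_trans _ _ (\sum_(k j <= i < k j.+1) ((Num.sqrt n%:R * m.+1%:R)^-1) ^+ 2)).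
    rewrite big_nat_cond [leRHS]big_nat_cond; apply: ler_sum => i /andP[/andP[_ ik] _].
    have h := xle i (leq_trans ik knm); have h0 := normr_ge0 (x i).
    rewrite -[leLHS]real_normK ?num_real// ler_sqr// nnegrE.
    exact: le_trans h.
  rewrite sumr_const_nat exprVn exprMn sqr_sqrtr// invfM exprVn -[leLHS]mulr_natl mulrA.
  rewrite -[leRHS]mul1r ler_wpM2r ?invr_ge0 ?sqr_ge0//.
  rewrite ler_pdivrMr ?ltr0n// mul1r ler_nat; apply: leq_trans knm; exact: leq_subr.
apply: (@le_trans _ _ (m.+1%:R^-1 `^ p)).
  by rewrite powR_le_iff ?block_norm_ge0// invr_ge0.
apply: ge1r_powR; last exact: ltW.
by rewrite invr_gt0 ltr0n/= invf_le1 ?ltr0n// ler1n.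
Qed.

(** [block_convex] is summed over the blocks at [e = 1 / 8]. The slack then uses up half of the
    assumed separation, and the other half gives the gain, [1 / 64] being the product of [1 / 8]
    with this [e]. *)
Lemma pk_uniform_convex (D : R) a b : 0 <= D ->
  pk_sum a <= D `^ p -> pk_sum b <= D `^ p ->
  D `^ p / 4 <= pk_sum (fun i => a i - b i) ->
  pk_sum (fun i => 2^-1 * (a i + b i)) <= (1 - cvx_const p / 64) * D `^ p.
Proof.
move=> D0 aD bD abD.
have c0 := cvx_const_gt0 p12.
set PA := pk_sum a in aD; set PB := pk_sum b in bD.
set PC := pk_sum _ in abD; set PM := pk_sum _.
have : PC <= 1 / 8 * ((PA + PB) / 2) + (1 / 8 * cvx_const p)^-1 * ((PA + PB) / 2 - PM).
  rewrite /PA /PB /PC /PM /pk_sum -big_split/= mulr_suml -sumrB !mulr_sumr -big_split/=.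
  apply: ler_sum => j _; apply: block_convex => //; rewrite ?block_norm_ge0//.
  - exact: block_parallelogram.
  - have P := block_parallelogram k j a b.
    have CS := block_cauchy_schwarz k j a b.
    rewrite -ler_sqr ?nnegrE ?block_norm_ge0 ?divr_ge0 ?addr_ge0 ?block_norm_ge0//.
    have CE : block_norm k j (fun i => a i - b i) ^+ 2 =
       block_norm k j a ^+ 2 + block_norm k j b ^+ 2 - 2 * \sum_(k j <= i < k j.+1) a i * b i.
      rewrite !sqr_block_norm mulr_sumr -big_split/= -sumrB.
      by apply: eq_bigr => i _; ring.
    rewrite CE in P; nra.
  - lra.
have -> : (1 / 8 * cvx_const p)^-1 = 8 / cvx_const p by field; rewrite gt_eqF.
set c := cvx_const p in c0 *.
set X := D `^ p in aD bD abD *.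
move=> H.
have c8 : 0 < 8 / c by rewrite divr_gt0.
have H2 : X / 4 <= 1 / 8 * X + 8 / c * (X - PM).
  apply: (le_trans abD); apply: (le_trans H); apply: lerD; first by lra.
  by rewrite ler_wpM2l ?(ltW c8)//; lra.
have : c * (X / 8) <= c * (8 / c * (X - PM)) by rewrite ler_wpM2l ?(ltW c0)//; lra.
have -> : c * (8 / c * (X - PM)) = 8 * (X - PM) by field; rewrite gt_eqF.
lra.
Qed.

End pk.

(** * Lebesgue measure and iterated integrals in several dimensions *)

Section affine.
Context (R : realType).
Local Open Scope ereal_scope.
Local Notation T := (measurableTypeR R).
Local Notation leb := (@lebesgue_measure R).

Lemma measurable_affine (a b : R) :
  measurable_fun setT ((fun x => a * x + b)%R : T -> T).
Proof. by apply: measurable_funD => //; exact: measurable_funM. Qed.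

(** By uniqueness of Lebesgue measure: the rescaled pushforward has the right value on half-open
    intervals. *)
Lemma lebesgue_measure_affine (a b : R) (A : set T) : (0 < a)%R -> measurable A ->
  leb A = a%:E * leb ((fun x => a * x + b)%R @^-1` A).
Proof.
move=> a0 mA.
pose P : {measure set T -> \bar R} :=
  measure_function_pushforward__canonical__measure_function_Measure leb (measurable_affine a b).
have := @lebesgue_measure_unique R (mscale (NngNum (ltW a0)) P) _ A mA.
apply.
move=> _ [[s t] _ <-]; rewrite /mscale /= /pushforward.
rewrite [X in _ = _ * leb X](_ : _ = [set` `]((s - b) / a)%R, ((t - b) / a)%R]%R]); last first.
  apply/seteqP; split => x /=; rewrite !in_itv/= ltr_pdivrMr// ler_pdivlMr//;
    rewrite ltrBlDr lerBrDr mulrC//.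
rewrite !lebesgue_measure_itv /= !lte_fin ltr_pM2r ?invr_gt0// ltrD2r.
case: ifP => _; last by rewrite mule0.
by rewrite -!EFinD -EFinM; congr (_%:E); field; rewrite gt_eqF.
Qed.

Lemma integral_affine (a b : R) (G : T -> \bar R) : (0 < a)%R -> mnn G ->
  \int[leb]_x G x = a%:E * \int[leb]_x G (a * x + b)%R.
Proof.
move=> a0 [mG G0].
pose P : {measure set T -> \bar R} :=
  measure_function_pushforward__canonical__measure_function_Measure leb (measurable_affine a b).
transitivity (\int[mscale (NngNum (ltW a0)) P]_x G x).
  apply: eq_measure_integral => A mA _; rewrite /mscale/= /pushforward.
  exact: lebesgue_measure_affine.
rewrite ge0_integral_mscale//; congr (_ * _).
rewrite (ge0_integral_pushforward (measurable_affine a b))//.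
Qed.

End affine.

Section iint_theory.
Context (R : realType).
Local Open Scope ereal_scope.
Local Notation T := (measurableTypeR R).
Local Notation leb := (@lebesgue_measure R).

Definition lebn (n : nat) : {sigma_finite_measure set (sq T) -> \bar R} :=
  pow leb (0%R : T) n.

Lemma iint_giint N (f : sq T -> \bar R) : iint N f = giint leb (0%R : T) N f.
Proof. by elim: N f => // N IH f; apply: eq_integral => x _; exact: IH. Qed.

Lemma iintE N (f : sq T -> \bar R) : mnn f -> iint N f = \int[lebn N]_x f x.
Proof. by move=> [mf f0]; rewrite iint_giint giintE. Qed.

Lemma eq_iint N (f g : (nat -> R) -> \bar R) : f =1 g -> iint N f = iint N g.
Proof. by move=> fg; congr (iint N _); apply/funext. Qed.

Definition sq_trunc (n : nat) (x : nat -> R) : nat -> R :=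
  fun i => if (i < n)%N then x i else 0%R.

(** [iint] sets the coordinates from [N] on to [0], so truncating there goes unseen. The points
    produced by [cpt] are truncated in this way. *)
Lemma iint_trunc N (f : (nat -> R) -> \bar R) :
  iint N (fun x => f (sq_trunc N x)) = iint N f.
Proof.
elim: N f => [|N IH] f; first by congr f; apply/funext.
apply: eq_integral => x _; rewrite -[RHS]IH; apply: eq_iint => y.
by congr f; apply/funext => -[].
Qed.

Definition sq_cat (n : nat) (x y : nat -> R) : nat -> R :=
  fun i => if (i < n)%N then x i else y (i - n)%N.

Lemma iint_cat a b (f : (nat -> R) -> \bar R) :
  iint (a + b) f = iint a (fun x => iint b (fun y => f (sq_cat a x y))).
Proof.
elim: a f => [|a IH] f.
  by apply: eq_iint => y; congr f; apply/funext => i; rewrite /sq_cat subn0.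
apply: eq_integral => x _.
transitivity (iint a (fun y => iint b (fun z => f (Defs.ncons x (sq_cat a y z))))).
  exact: (IH (fun y => f (Defs.ncons x y))).
apply: eq_iint => y; apply: eq_iint => z.
by congr f; apply/funext => -[|i].
Qed.

Lemma cpt_cat n (x y : nat -> R) :
  cpt n (sq_cat n x y) = scons (sq_trunc n x) (cpt n y).
Proof.
apply/funext => -[|i]; apply/funext => j; rewrite /cpt /sq_trunc /sq_cat /=; case: ifP => // jn.
  by rewrite mul0n add0n jn.
by rewrite mulSn -addnA ltnNge leq_addr/= addKn.
Qed.

(** Passage from the flat integral over [t * n] real coordinates in [Zhat] to [t] points of an
    abstract space, where [gnz] is available. *)
Lemma iint_cpt n t (h : sq (sq T) -> \bar R) : mnn h ->
  iint (t * n) (fun z => h (cpt n z)) =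
  \int[pow (lebn n) (fun=> 0%R : T) t]_x h x.
Proof.
elim: t h => [|t IH] h mh.
  rewrite mul0n integral_pow0; last exact: mh.1.
  by congr h; apply/funext => i; apply/funext => j; rewrite /cpt; case: ifP.
rewrite integral_powS; [|exact: mh.1|exact: mh.2].
have mh2 : mnn (fun z : sq T * sq (sq T) => h (scons z.1 z.2)).
  by apply: (mnn_comp mh); exact: measurable_scons.
rewrite mulSn iint_cat -iintE; last exact: (mnn_integral _ mh2).
rewrite -[RHS]iint_trunc; apply: eq_iint => x.
rewrite -(IH (fun y => h (scons (sq_trunc n x) y))); last first.
  apply: (mnn_comp mh); apply: measurable_scons2; last exact: measurable_id.
  exact: measurable_cst.
by apply: eq_iint => y; rewrite cpt_cat.
Qed.

Lemma measurable_sq_affine (a : R) (b : nat -> R) :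
  measurable_fun setT ((fun x i => a * x i + b i)%R : sq T -> sq T).
Proof.
apply: measurable_fun_sq => i; apply: measurable_funD => //.
by apply: measurable_funM => //; exact: measurable_coord.
Qed.

(** Coordinates from [N] on are frozen at [0] and the map would move them, hence the requirement
    that [f] ignore them. *)
Lemma lebn_affine N (a : R) (b : nat -> R) (f : sq T -> \bar R) : (0 < a)%R -> mnn f ->
  (forall x y, (forall i, (i < N)%N -> x i = y i) -> f x = f y) ->
  \int[lebn N]_x f x = (a ^+ N)%:E * \int[lebn N]_x f (fun i => a * x i + b i)%R.
Proof.
move=> a0; elim: N b f => [|N IH] b f mf locf.
  rewrite !integral_pow0; [|exact: (mnn_comp mf (measurable_sq_affine a b)).1|exact: mf.1].
  by rewrite expr0 mul1e; exact: locf.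
have mf2 : mnn (fun z : T * sq T => f (scons z.1 z.2)).
  by apply: (mnn_comp mf); exact: measurable_scons.
have mf3 := mnn_integral (lebn N) mf2.
have mfa := mnn_comp mf (measurable_sq_affine a b).
have mfa2 : mnn (fun z : T * sq T => f (fun i => a * scons z.1 z.2 i + b i)%R).
  by apply: (mnn_comp mfa); exact: measurable_scons.
have mfa3 := mnn_integral (lebn N) mfa2.
rewrite integral_powS; [|exact: mf.1|exact: mf.2].
rewrite integral_powS; [|exact: mfa.1|exact: mfa.2].
rewrite (integral_affine (b 0%N) a0 mf3) exprS EFinM -muleA; congr (_ * _).
rewrite -ge0_integralZl//; [|exact: mfa3.1|by move=> x _; exact: mfa3.2|by rewrite lee_fin exprn_ge0// ltW].
apply: eq_integral => x _ /=.
rewrite (IH (fun i => b i.+1)).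
- congr (_ * _); apply: eq_integral => y _; congr f.
  by apply/funext => -[].
- apply: (mnn_comp mf); apply: measurable_scons2; last exact: measurable_id.
  exact: measurable_cst.
- by move=> y z yz; apply: locf => -[|i]//= iN; exact: yz.
Qed.

End iint_theory.

Lemma ind_iff d d' (X : measurableType d) (Y : measurableType d') (R : realType)
    (A : set X) (B : set Y) x y : (A x <-> B y) -> ind A x = ind B y :> \bar R.
Proof.
move=> AB; have [Ax|Ax] := pselect (A x); first by rewrite !ind_in//; exact/AB.
by rewrite !ind_out// => /AB.
Qed.

(** * Volumes of balls of the mixed norm *)

Section pk_volume.
Context (R : realType) (p : R) (m n : nat) (k : nat -> nat).
Hypothesis p12 : 1 < p <= 2.
Hypotheses (k0 : k 0%N = 0%N) (km : k m = n).
Hypothesis (kinc : forall j, (j < m)%N -> (k j < k j.+1)%N).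
Hypothesis (n0 : (0 < n)%N).
Local Notation T := (measurableTypeR R).
Local Notation leb := (@lebesgue_measure R).
Local Notation mu := (lebn R n).
Local Notation N := (pk_norm p m k).

Lemma measurable_pk_norm d (X : measurableType d) (f : X -> sq T) :
  measurable_fun setT f -> measurable_fun setT (fun x => N (f x) : R).
Proof.
move=> mf; apply: (measurableT_comp (measurable_powR p^-1)).
apply: measurable_sum => j; apply: (measurableT_comp (measurable_powR p)).
have ms : measurable_fun [set: R] (Num.sqrt : R -> R).
  by apply: continuous_measurable_fun; exact: sqrt_continuous.
apply: (measurableT_comp ms).
apply: measurable_sum => i; apply: measurable_funX.
exact: (measurableT_comp (@measurable_coord _ T i) mf).
Qed.

Lemma measurable_pk_dist :
  measurable_fun setT (fun z : sq T * sq T => pk_dist p m k z.1 z.2 : R).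
Proof.
apply: measurable_pk_norm; apply: measurable_fun_sq => i; apply: measurable_funB.
  exact: (measurableT_comp (@measurable_coord _ T i) measurable_snd).
exact: (measurableT_comp (@measurable_coord _ T i) measurable_fst).
Qed.

Lemma measurable_pk_ball x r : measurable (pk_ball p m k x r : set (sq T)).
Proof.
rewrite (_ : pk_ball p m k x r = (fun y : sq T => N (fun i => y i - x i) : R) @^-1` [set` `]-oo, r]]); last first.
  by apply/seteqP; split => y; rewrite /pk_ball /pk_dist /= in_itv.
apply: measurable_preimage => //; apply: measurable_pk_norm.
apply: measurable_fun_sq => i; apply: measurable_funB => //.
exact: measurable_coord.
Qed.

Lemma volE (A : set (sq T)) : measurable A -> vol n A = mu A.
Proof.
move=> mA; rewrite /vol -(integral_ind mu mA) -iintE//.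
exact: mnn_indicator.
Qed.

Definition unit_vol : \bar R := mu (pk_ball p m k (origin R) 1).

Lemma pk_ball_vol x r : 0 < r ->
  mu (pk_ball p m k x r) = ((r ^+ n)%:E * unit_vol)%E.
Proof.
move=> r0.
have mB1 := measurable_pk_ball (origin R) 1.
have mB := measurable_pk_ball x r.
rewrite -(integral_ind mu mB) /unit_vol -(integral_ind mu mB1).
have loc (y z : sq T) : (forall i, (i < n)%N -> y i = z i) ->
    ind (pk_ball p m k x r : set (sq T)) y = ind (pk_ball p m k x r : set (sq T)) z :> \bar R.
  move=> yz; apply: ind_iff; rewrite /pk_ball /= /pk_dist.
  have -> : N (fun i => y i - x i) = N (fun i => z i - x i) by apply: (eq_pk_norm p km kinc) => i ni; rewrite yz.
  by [].
rewrite (lebn_affine x r0 (mnn_indicator R mB) loc); congr (_ * _)%E.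
apply: eq_integral => y _.
apply: ind_iff.
have E : pk_dist p m k x (fun i => r * y i + x i) = r * pk_dist p m k (origin R) y.
  rewrite /pk_dist; have -> : (fun i => r * y i + x i - x i) = (fun i => r * (y i - origin R i)).
    by apply/funext => i; rewrite addrK /origin subr0.
  by rewrite pk_normZ// ltW.
change (pk_dist p m k x (fun i => r * y i + x i) <= r <-> pk_dist p m k (origin R) y <= 1).
by rewrite E ger_pMr.
Qed.

Lemma box_vol (s : R) : 0 <= s ->
  mu [set x : sq T | forall i, (i < n)%N -> `|x i| <= s] = ((2 * s) ^+ n)%:E.
Proof.
move=> s0.
pose I : set T := [set` `[-s, s]%R].
have mI : measurable I by exact: measurable_itv.
have mb : measurable [set x : sq T | forall i, (i < n)%N -> I (x i)].
  apply: measurable_set_forall => i; apply: measurable_set_imply.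
  exact: (measurable_preimage (@measurable_coord _ T i)).
have leI : leb I = (2 * s)%:E.
  rewrite /I lebesgue_measure_itv/= lte_fin.
  case: ltP => h; first by rewrite -EFinD; congr (_%:E); lra.
  by congr (_%:E); lra.
have Ioo : (leb I < +oo)%E by rewrite leI ltry.
have E := integral_pow_box (0 : T) mI Ioo n; rewrite integral_ind// in E.
transitivity (fine (leb I) ^+ n)%:E; last by rewrite leI.
have IE y : I y <-> `|y| <= s by rewrite /I /= in_itv/= ler_norml.
by apply: etrans E; congr (mu _); apply/seteqP; split => x h i ni; apply/IE; exact: h.
Qed.

Lemma measurable_box (s : R) :
  measurable [set x : sq T | forall i, (i < n)%N -> `|x i| <= s].
Proof.
rewrite (_ : [set _ | _] = [set x : sq T | forall i, (i < n)%N -> [set` `[-s, s]%R] (x i)]).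
  apply: measurable_set_forall => i; apply: measurable_set_imply.
  apply: (measurable_preimage (@measurable_coord _ T i)); exact: measurable_itv.
by apply/seteqP; split => x h i ni; have := h i ni; rewrite /= in_itv/= ler_norml.
Qed.

Lemma unit_vol_fin : (unit_vol < +oo)%E.
Proof.
apply: (@le_lt_trans _ _ (mu [set x : sq T | forall i, (i < n)%N -> `|x i| <= 1])); last first.
  by rewrite box_vol// ltry.
apply: le_measure; rewrite ?inE.
- exact: measurable_pk_ball.
- exact: measurable_box.
move=> x; rewrite /pk_ball /= /pk_dist => h i ni.
apply: le_trans h; have := coord_le_pk_norm p12 k0 km (fun i => x i - origin R i) ni.
by rewrite /origin subr0.
Qed.

Lemma unit_vol_gt0 : (0 < unit_vol)%E.
Proof.
set s : R := (Num.sqrt n%:R * m.+1%:R)^-1.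
have s0 : 0 < s by rewrite invr_gt0 mulr_gt0// ?sqrtr_gt0 ltr0n.
apply: (@lt_le_trans _ _ (mu [set x : sq T | forall i, (i < n)%N -> `|x i| <= s])).
  by rewrite box_vol ?ltW// lte_fin exprn_gt0// mulr_gt0.
apply: le_measure; rewrite ?inE.
- exact: measurable_box.
- exact: measurable_pk_ball.
move=> x h.
change (pk_norm p m k (fun i => x i - origin R i) <= 1).
apply: (pk_norm_cube p12 km kinc n0) => i ni.
by rewrite /origin subr0; exact: h.
Qed.

Definition unit_volr : R := fine unit_vol.

Lemma unit_volrE : unit_vol = unit_volr%:E.
Proof. by rewrite fineK// ge0_fin_numE ?unit_vol_fin// ltW// unit_vol_gt0. Qed.

Lemma unit_volr_gt0 : 0 < unit_volr.
Proof. by rewrite -lte_fin -unit_volrE unit_vol_gt0. Qed.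

Lemma r_nP : 0 < r_n p m k n /\ r_n p m k n ^+ n * unit_volr = 1.
Proof.
have u0 := unit_volr_gt0.
have nR : n%:R != 0 :> R by rewrite pnatr_eq0 -lt0n.
have : [set r : R | 0 < r /\ vol n (pk_ball p m k (origin R) r) = 1%:E] (r_n p m k n).
  (* [r_n] is picked by [xget], so a radius of unit volume has to be exhibited: the [n]-th root of
     the inverse of [unit_volr]. *)
  rewrite /r_n; case: xgetP => // /(_ (unit_volr `^ (- n%:R^-1)))[].
  split; first exact: powR_gt0.
  rewrite volE; last exact: measurable_pk_ball.
  rewrite pk_ball_vol; last exact: powR_gt0.
  rewrite unit_volrE -EFinM; congr (_%:E).
  rewrite -powR_mulrn ?powR_ge0// -powRrM mulNr mulVf// powR_inv1 ?ltW//.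
  by rewrite mulVf// gt_eqF.
move=> [r0]; rewrite volE; last exact: measurable_pk_ball.
by rewrite pk_ball_vol// unit_volrE -EFinM => -[].
Qed.

Lemma pk_ball_volr x r : 0 < r ->
  mu (pk_ball p m k x r) = ((r / r_n p m k n) ^+ n)%:E.
Proof.
move=> r0; have [rn0 rnE] := r_nP.
rewrite pk_ball_vol// unit_volrE -EFinM; congr (_%:E).
rewrite expr_div_n -[LHS]mulr1 -[in LHS](mulfV (x := r_n p m k n ^+ n)) ?expf_neq0 ?gt_eqF//.
have -> : r ^+ n * unit_volr * (r_n p m k n ^+ n / r_n p m k n ^+ n) =
  r ^+ n * (r_n p m k n ^+ n * unit_volr) / r_n p m k n ^+ n by ring.
by rewrite rnE mulr1.
Qed.

End pk_volume.

(** * Overlap of exclusion balls *)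

(* Each pair is charged to the one of its two points where [rho] is larger. *)
Lemma pair_integral_le d (E : measurableType d) (R : realType)
    (mu : {sigma_finite_measure set E -> \bar R}) (A : set E) (near : set (E * E))
    (rho : E -> R) (K : R) :
  measurable A -> measurable near -> measurable_fun setT rho ->
  (forall y z, near (y, z) -> near (z, y)) -> 0 <= K ->
  (forall y, A y -> (mu [set z | near (y, z) /\ (rho z <= rho y)%R] <= K%:E)%E) ->
  (\int[mu]_y (ind A y * \int[mu]_z (ind A z * ind near (y, z))) <= (2 * K)%:E * mu A)%E.
Proof.
move=> mA mnear mrho nearC K0 hK.
pose Q : set (E * E) := [set w | near w /\ rho w.2 <= rho w.1].
have mle : measurable [set w : E * E | rho w.2 <= rho w.1].
  rewrite (_ : [set _ | _] = (fun w : E * E => rho w.1 - rho w.2) @^-1` [set` `[0, +oo[%R]); last first.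
    by apply/seteqP; split => w /=; rewrite in_itv/= andbT subr_ge0.
  apply: measurable_preimage => //; apply: measurable_funB.
    exact: (measurableT_comp mrho measurable_fst).
  exact: (measurableT_comp mrho measurable_snd).
have mQ : measurable Q := measurableI _ _ mnear mle.
have mi1 : mnn (fun w : E * E => ind A w.1 : \bar R).
  exact: (mnn_comp (mnn_indicator R mA) measurable_fst).
have mi2 : mnn (fun w : E * E => ind A w.2 : \bar R).
  exact: (mnn_comp (mnn_indicator R mA) measurable_snd).
(* Pairs charged to their first point. A tie in [rho] is charged to both points, which is harmless
   in an upper bound. *)
pose f (w : E * E) : \bar R := (ind A w.1 * (ind A w.2 * ind Q w))%E.
have mf : mnn f by apply: mnn_mul => //; apply: mnn_mul => //; exact: mnn_indicator.
have mfs : mnn (fun w => f (w.2, w.1)).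
  by apply: (mnn_comp mf); apply: measurable_fun_pair.
have mnearA : mnn (fun w : E * E => (ind A w.2 * ind near w)%E : \bar R).
  by apply: mnn_mul => //; exact: mnn_indicator.
have half : (\int[mu]_y \int[mu]_z f (y, z) <= K%:E * mu A)%E.
  rewrite -(integral_ind mu mA) -ge0_integralZl//; last first.
    exact: measurable_ind.
  apply: ge0_integral_le.
  - exact: (mnn_integral mu mf).
  - by apply: mnn_mul; [exact: mnn_cst|exact: mnn_indicator].
  move=> y; have [Ay|Ay] := pselect (A y); last first.
    rewrite integral0_eq; first by rewrite mule_ge0// ind_ge0.
    by move=> z _; rewrite /f (ind_out Ay) mul0e.
  rewrite (ind_in Ay) mule1; apply: le_trans (hK y Ay).
  have mQy : measurable [set z | near (y, z) /\ rho z <= rho y].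
    by apply: (@measurable_preimage _ _ _ _ (fun z => (y, z)) Q) => //; exact: measurable_pair1.
  rewrite -(integral_ind mu mQy); apply: ge0_integral_le.
  - by apply: (mnn_comp mf); exact: measurable_pair1.
  - exact: mnn_indicator.
  move=> z; rewrite /f /= (ind_in Ay) mul1e.
  have [h|h] := pselect (Q (y, z)).
    by rewrite (ind_in h) mule1 [leRHS]ind_in// ind_le1.
  by rewrite (ind_out h) mule0 ind_ge0.
have mfi := mnn_integral mu mf.
have mfsi := mnn_integral mu mfs.
have swap : (\int[mu]_y \int[mu]_z f (z, y) = \int[mu]_y \int[mu]_z f (y, z))%E.
  by rewrite -(fubini_tonelli f)//; [exact: mf.1|exact: mf.2].
have -> : ((2 * K)%:E * mu A = K%:E * mu A + K%:E * mu A)%E.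
  by rewrite -ge0_muleDl ?lee_fin// -EFinD; congr (_%:E * _)%E; ring.
apply: (@le_trans _ _ (\int[mu]_y \int[mu]_z f (y, z) + \int[mu]_y \int[mu]_z f (z, y))%E); last first.
  by rewrite swap leeD.
rewrite -[leRHS](ge0_integralD mu measurableT (fun y _ => mfi.2 y) mfi.1 (fun y _ => mfsi.2 y) mfsi.1).
apply: ge0_integral_le.
- exact: (mnn_mul (mnn_indicator R mA) (mnn_integral mu mnearA)).
- exact: (mnn_add mfi mfsi).
move=> y.
have mfy : mnn (fun z => f (y, z)) by apply: (mnn_comp mf); exact: measurable_pair1.
have mfy2 : mnn (fun z => f (z, y)) by apply: (mnn_comp mf); exact: measurable_pair2.
have mny : mnn (fun z => (ind A z * ind near (y, z))%E : \bar R).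
  exact: (mnn_comp mnearA (measurable_pair1 y)).
rewrite -[leRHS](ge0_integralD mu measurableT (fun z _ => mfy.2 z) mfy.1 (fun z _ => mfy2.2 z) mfy2.1).
rewrite -[leLHS](ge0_integralZl mu measurableT mny.1 (fun z _ => mny.2 z) (ind_ge0 _ A y)).
apply: ge0_integral_le.
- exact: (mnn_mul (mnn_cst _ (ind_ge0 _ A y)) mny).
- exact: (mnn_add mfy mfy2).
move=> z; rewrite /f /=.
have [Ay|Ay] := pselect (A y); last by rewrite (ind_out Ay) !(mul0e, mule0) adde0.
have [Az|Az] := pselect (A z); last by rewrite (ind_out Az) !(mul0e, mule0) adde0.
rewrite (ind_in Ay) (ind_in Az) !mul1e.
have [h|h] := pselect (near (y, z)); last by rewrite (ind_out h) adde_ge0 ?ind_ge0.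
rewrite (ind_in h).
have /orP[zy|yz] := le_total (rho z) (rho y).
  have q : Q (y, z) by split.
  by rewrite (ind_in q); apply: leeDl; exact: ind_ge0.
have q : Q (z, y) by split => //; exact: nearC.
by rewrite (ind_in q); apply: leeDr; exact: ind_ge0.
Qed.

(** The [p]-th root turns the contraction of [pk_sum] in [pk_uniform_convex] into one of norms. *)
Definition cvx_radius (R : realType) (p : R) : R := (1 - cvx_const p / 64) `^ p^-1.

Section cvx_radius.
Context (R : realType) (p : R).
Hypothesis p12 : 1 < p <= 2.

Let p0 : 0 < p. Proof. by case/andP: p12 => p1 _; exact: lt_trans p1. Qed.

Lemma cvx_radius_powR : cvx_radius p `^ p = 1 - cvx_const p / 64.
Proof.
rewrite /cvx_radius -powRrM mulVf ?gt_eqF// powRr1//.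
have := cvx_const_le p12; lra.
Qed.

(** The lower bound makes the powers of [2 * cvx_radius p] at least [1], so that they absorb the
    other summand of [geo_const]. *)
Lemma cvx_radius_bounds : 1 / 2 <= cvx_radius p < 1.
Proof.
have c0 := cvx_const_gt0 p12; have c1 := cvx_const_le p12.
have r0 : 0 <= cvx_radius p by exact: powR_ge0.
apply/andP; split.
  apply: (@le_trans _ _ (1 - cvx_const p / 64)); first lra.
  rewrite /cvx_radius; apply: ger1_powR; first by apply/andP; split; lra.
  by rewrite invf_le1//; case/andP: p12 => /ltW.
rewrite ltNge; apply/negP => h.
have : 1 `^ p <= cvx_radius p `^ p by rewrite powR_le_iff.
rewrite powR1 cvx_radius_powR; lra.
Qed.

End cvx_radius.

Section geometry.
Context (R : realType) (p : R) (m n : nat) (k : nat -> nat).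
Hypothesis p12 : 1 < p <= 2.
Hypotheses (k0 : k 0%N = 0%N) (km : k m = n).
Hypothesis (kinc : forall j, (j < m)%N -> (k j < k j.+1)%N).
Hypothesis (n0 : (0 < n)%N).
Local Notation T := (measurableTypeR R).
Local Notation mu := (lebn R n).
Local Notation N := (pk_norm p m k).
Local Notation rn := (r_n p m k n).
Local Notation theta := (cvx_radius p).

Definition pk_far : set (sq T * sq T) := [set z | 2 * rn <= pk_dist p m k z.1 z.2].

Lemma measurable_pk_far : measurable pk_far.
Proof.
rewrite (_ : pk_far = (fun z : sq T * sq T => pk_dist p m k z.1 z.2 : R) @^-1` [set` `[2 * rn, +oo[%R]); last first.
  by apply/seteqP; split => z; rewrite /pk_far /= in_itv/= andbT.
by apply: measurable_preimage => //; exact: measurable_pk_dist.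
Qed.

Lemma pk_farC x y : pk_far (x, y) -> pk_far (y, x).
Proof. by rewrite /pk_far /= pk_distC. Qed.

Lemma pk_nearP x y : (~` pk_far) (x, y) <-> pk_dist p m k x y < 2 * rn.
Proof.
rewrite /pk_far /setC /=; split => [/negP|h]; first by rewrite -ltNge.
by apply/negP; rewrite -ltNge.
Qed.

Lemma measurable_pk_near_sect y : measurable [set z : sq T | (~` pk_far) (z, y)].
Proof.
apply: (@measurable_preimage _ _ _ _ (fun z : sq T => (z, y)) (~` pk_far)).
  exact: measurable_pair2.
by apply: measurableC; exact: measurable_pk_far.
Qed.

Let rn0 : 0 < rn. Proof. by have [] := r_nP p12 k0 km kinc n0. Qed.

Lemma pk_near_vol y : (mu [set z : sq T | (~` pk_far) (z, y)] <= (2 ^+ n)%:E)%E.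
Proof.
have D0 : 0 < 2 * rn by rewrite mulr_gt0.
have -> : (2 ^+ n)%:E = mu (pk_ball p m k y (2 * rn)).
  by rewrite (pk_ball_volr p12 k0 km kinc n0)// mulfK// gt_eqF.
apply: le_measure; rewrite ?inE.
- exact: measurable_pk_near_sect.
- exact: measurable_pk_ball.
by move=> z /pk_nearP; rewrite pk_distC => /ltW.
Qed.

(* In [pk_lens_vol] the lens lies in a ball of radius [r_n] around [u] if [y] is within
   [r_n] of [u], and in a ball of radius [2 * theta * r_n] around their midpoint otherwise. *)
Definition geo_const : R := 1 + (2 * theta) ^+ n.

Lemma geo_const_ge0 : 0 <= geo_const.
Proof. by rewrite addr_ge0// exprn_ge0// mulr_ge0// powR_ge0. Qed.

Lemma pk_lens_vol (u y : sq T) : pk_dist p m k u y < 2 * rn ->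
  (mu [set z : sq T | (~` pk_far) (y, z) /\ (pk_dist p m k u z <= pk_dist p m k u y)%R]
   <= geo_const%:E)%E.
Proof.
move=> uy; set D := 2 * rn in uy.
have D0 : 0 < D by rewrite mulr_gt0.
have mS : measurable [set z : sq T | (~` pk_far) (y, z) /\ (pk_dist p m k u z <= pk_dist p m k u y)%R].
  have mnear : measurable (~` pk_far) by apply: measurableC; exact: measurable_pk_far.
  have m1 : measurable [set z : sq T | (~` pk_far) (y, z)].
    exact: (measurable_preimage (measurable_pair1 y) mnear).
  exact: (measurableI _ _ m1 (measurable_pk_ball p m k u (pk_dist p m k u y))).
have th0 : 0 < theta by case/andP: (cvx_radius_bounds p12) => h _; lra.
have /orP[close|distant] := le_total (pk_dist p m k u y) rn.
  apply: (@le_trans _ _ (mu (pk_ball p m k u rn))).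
    apply: le_measure; rewrite ?inE; [exact: mS|exact: measurable_pk_ball|].
    move=> z [_ h]; change (pk_dist p m k u z <= rn).
    exact: le_trans h close.
  rewrite (pk_ball_volr p12 k0 km kinc n0)// divff ?gt_eqF// expr1n lee_fin /geo_const.
  by rewrite lerDl exprn_ge0// mulr_ge0// ltW.
pose c i := 2^-1 * (u i + y i).
apply: (@le_trans _ _ (mu (pk_ball p m k c (theta * D)))); last first.
  rewrite (pk_ball_volr p12 k0 km kinc n0) ?mulr_gt0// lee_fin /geo_const.
  have -> : theta * D / rn = 2 * theta by rewrite /D; field; rewrite gt_eqF.
  by rewrite lerDr.
apply: le_measure; rewrite ?inE; [exact: mS|exact: measurable_pk_ball|].
move=> z [/pk_nearP yz uz].
change (N (fun i => z i - c i) <= theta * D).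
have tD0 : 0 <= theta * D by rewrite mulr_ge0// ltW.
rewrite pk_norm_le// (powRM _ (ltW th0) (ltW D0)) cvx_radius_powR//.
have -> : (fun i => z i - c i) = (fun i => 2^-1 * ((z i - u i) + (z i - y i))).
  by apply/funext => i; rewrite /c; field.
(* The vectors from [u] and from [y] to [z]: half their sum is [z - c], and their difference is
   [y - u]. *)
apply: (@pk_uniform_convex R p m k p12 D (fun i => z i - u i) (fun i => z i - y i)); first exact: ltW.
- rewrite -(pk_norm_le m k p12 _ (ltW D0)).
  change (pk_dist p m k u z <= D); exact: le_trans uz (ltW uy).
- rewrite -(pk_norm_le m k p12 _ (ltW D0)).
  change (pk_dist p m k y z <= D); exact: (ltW yz).
have -> : (fun i => z i - u i - (z i - y i)) = (fun i => y i - u i).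
  by apply/funext => i; ring.
rewrite -(pk_norm_powR _ _ p12).
apply: (@le_trans _ _ (rn `^ p)); last by rewrite powR_le_iff ?pk_norm_ge0// ltW.
have -> : rn = 2^-1 * D by rewrite /D; field.
have h0 : 0 <= 2^-1 :> R by rewrite invr_ge0.
rewrite (powRM _ h0 (ltW D0)) mulrC; apply: ler_wpM2r; first exact: powR_ge0.
(* Here [p <= 2] enters: the [p]-th power of [1 / 2] is at least [1 / 4]. *)
have -> : 4^-1 = 2^-1 `^ 2 :> R by rewrite powR_mulrn//; field.
apply: ger_powR; last by case/andP: p12.
by rewrite invr_gt0 ltr0n invf_le1 ?ltr0n// ler1n.
Qed.

Lemma pk_geo (u : sq T) (A : set (sq T)) : measurable A ->
  A `<=` [set y | (~` pk_far) (u, y)] ->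
  (\int[mu]_y (ind A y * \int[mu]_z (ind A z * ind (~` pk_far) (y, z))) <=
   (2 * geo_const)%:E * mu A)%E.
Proof.
move=> mA Au.
have mnear : measurable (~` pk_far) by apply: measurableC; exact: measurable_pk_far.
have mrho : measurable_fun setT (fun z : sq T => pk_dist p m k u z : R).
  apply: measurable_pk_norm; apply: measurable_fun_sq => i; apply: measurable_funB.
    exact: measurable_coord.
  exact: measurable_cst.
have nearC (y z : sq T) : (~` pk_far) (y, z) -> (~` pk_far) (z, y).
  by move=> yz /pk_farC.
have lens (y : sq T) (Ay : A y) := pk_lens_vol ((pk_nearP _ _).1 (Au y Ay)).
exact: (pair_integral_le mA mnear mrho nearC geo_const_ge0 lens).
Qed.

End geometry.

(** * The density bound in a ball and its integration in log-fugacity *)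

Section partition.
Context (R : realType) (p : R) (m n : nat) (k : nat -> nat).
Hypothesis p12 : 1 < p <= 2.
Hypotheses (k0 : k 0%N = 0%N) (km : k m = n).
Hypothesis (kinc : forall j, (j < m)%N -> (k j < k j.+1)%N).
Hypothesis (n0 : (0 < n)%N).
Variables (Rad : R).
Hypothesis (Rad0 : 0 < Rad).
Local Notation T := (measurableTypeR R).
Local Notation mu := (lebn R n).
Local Notation rn := (r_n p m k n).
Local Notation S := (pk_ball p m k (origin R) Rad : set (sq T)).
Local Notation c := (Zhat p m k n S).
Local Notation e0 := ((fun=> 0) : sq T).
Local Notation far := (pk_far p m n k).
Local Notation W := (W mu e0 S far).
Local Notation V := ((Rad / rn) ^+ n).

Let mS : measurable S. Proof. exact: measurable_pk_ball. Qed.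
Let mfar : measurable far. Proof. exact: measurable_pk_far. Qed.
Let muS : mu S = V%:E. Proof. exact: pk_ball_volr. Qed.
Let Sfin : (mu S < +oo)%E. Proof. by rewrite muS ltry. Qed.

Lemma ball_volE : vol n (pk_ball p m k (origin R) Rad) = V%:E.
Proof. by rewrite volE. Qed.

Lemma ZhatE t : c t =
  ((t`!%:R^-1)%:E * \int[pow mu e0 t]_x ind (admissible S far t) x)%E.
Proof.
rewrite /Zhat -iint_cpt; last by apply: mnn_indicator; exact: measurable_admissible.
congr (_ * _)%E; apply: eq_iint => z.
Qed.

Lemma Zhat_ge0 t : (0 <= c t)%E.
Proof.
by rewrite ZhatE mule_ge0// ?lee_fin ?invr_ge0//; apply: integral_ge0 => x _; exact: ind_ge0.
Qed.

Lemma Zhat0 : c 0%N = 1%E.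
Proof.
rewrite ZhatE fact0 invr1 mul1e integral_pow0 ?ind_in//.
by apply: measurable_ind; exact: measurable_admissible.
Qed.

Lemma gfun_W l : gfun c l = W l (fun _ _ => 1%E).
Proof.
apply: eq_eseriesr => t _; rewrite ZhatE muleA -EFinM; congr (_ * _)%E.
by apply: eq_integral => x _; rewrite mule1.
Qed.

Lemma gfun1_W l : gfun1 c l = W l (fun t _ => t%:R%:E).
Proof.
apply: eq_eseriesr => t _; rewrite ZhatE.
have mA : measurable (admissible S far t) by exact: measurable_admissible.
rewrite (ge0_integralZr _ measurableT (measurable_ind mA)) ?lee_fin//.
rewrite [LHS]muleA -EFinM /wt [RHS]muleA [RHS]muleAC -EFinM; congr (_%:E * _)%E; ring.
Qed.

Lemma gfun_fin l : 0 < l -> (gfun c l < +oo)%E.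
Proof. by move=> l0; rewrite gfun_W; exact: W1_fin. Qed.

(** Since [t <= 2 ^ t], this series at [l] is dominated by the partition function at [2 * l]. *)
Lemma gfun1_fin l : 0 < l -> (gfun1 c l < +oo)%E.
Proof.
move=> l0; apply: (@le_lt_trans _ _ (gfun c (2 * l))); last by apply: gfun_fin; rewrite mulr_gt0.
apply: lee_nneseries => [t _ _|t _].
  by rewrite mule_ge0 ?Zhat_ge0// lee_fin mulr_ge0// exprn_ge0// ltW.
apply: lee_wpmul2r; first exact: Zhat_ge0.
rewrite lee_fin exprMn; apply: ler_wpM2r; first by rewrite exprn_ge0// ltW.
by rewrite -natrX ler_nat ltnW// ltn_expl.
Qed.

(** The empty configuration alone contributes [1]. Hence [log Z] is nonnegative, which starts the
    Riemann sum and settles the parameters at which the density bound says nothing. *)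
Lemma gfun_ge1 l : 0 < l -> (1 <= gfun c l)%E.
Proof.
move=> l0.
apply: (@le_trans _ _ (\sum_(0 <= t < 1) ((l ^+ t)%:E * c t))%E).
  by rewrite big_nat1 expr0 mul1e Zhat0.
apply: nneseries_lim_ge => t _ _.
by apply: mule_ge0; [rewrite lee_fin exprn_ge0// ltW|exact: Zhat_ge0].
Qed.

Lemma gfunr_ge1 l : 0 < l -> 1 <= fine (gfun c l).
Proof.
move=> l0; rewrite -lee_fin fineK; first exact: gfun_ge1.
rewrite ge0_fin_numE ?gfun_fin// gfun_ge0 ?ltW//; exact: Zhat_ge0.
Qed.

Lemma density_real (l a : R) : 0 < l -> 0 <= a -> l * (2 * geo_const p n) < 1 ->
  (1 - l * (2 * geo_const p n)) * (expR (- a) * (1 + a)) * (V * fine (gfun c l)) <=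
  ((1 - l * (2 * geo_const p n)) / l + expR (- a) * 2 ^+ n) * fine (gfun1 c l).
Proof.
move=> l0 a0 lk.
have kap0 : 0 <= 2 * geo_const p n by rewrite mulr_ge0// geo_const_ge0.
have V00 : 0 <= 2 ^+ n :> R by rewrite exprn_ge0.
have geo u (Su : S u) (A : set (sq T)) (mA : measurable A)
    (Au : A `<=` [set y | (~` far) (u, y)]) (_ : (mu A < +oo)%E) :=
  pk_geo p12 k0 km kinc n0 mA Au.
have nv y (Sy : S y) := pk_near_vol p12 k0 km kinc n0 y.
have := hard_core_density e0 mS mfar (@pk_farC R p m n k) l0 Sfin kap0 V00 lk a0 geo nv.
rewrite muS -gfun_W -gfun1_W.
rewrite -[gfun c l]fineK; last first.
  by rewrite ge0_fin_numE ?gfun_fin// gfun_ge0 ?ltW//; exact: Zhat_ge0.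
rewrite -[gfun1 c l]fineK; last first.
  by rewrite ge0_fin_numE ?gfun1_fin// gfun1_ge0 ?ltW//; exact: Zhat_ge0.
by rewrite -!EFinM lee_fin.
Qed.

End partition.

(** After multiplication by [expR a] the void term is at most [sig * M] and the crowded one is [M],
    so the choice of [a] costs a factor [1 + sig]. Passing from [e] to [e1] gives one constant for
    all fugacities up to the last. *)
Lemma density_ratio (R : realType) (l a e e1 V Z A M sig : R) :
  0 < l -> 0 <= a -> 0 <= e -> e <= e1 -> e1 <= 1 -> 0 < Z -> 0 <= A -> 0 <= V ->
  0 < M -> 0 <= sig -> expR a <= sig * (l * M) ->
  (1 - e) * (expR (- a) * (1 + a)) * (V * Z) <= ((1 - e) / l + expR (- a) * M) * A ->
  V / M * ((1 - e1) / (1 + sig)) * a <= A / Z.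
Proof.
move=> l0 a0 e0 ee e11 Z0 A0 V0 M0 sig0 Ea H.
have s1 : 0 < 1 + sig by lra.
have E1 : expR a * expR (- a) = 1 by rewrite -expRD subrr expR0.
have Egt : 0 < expR a by exact: expR_gt0.
have VZ0 : 0 <= V * Z by rewrite mulr_ge0// ltW.
have H1 : (1 - e) * (1 + a) * (V * Z) <= ((1 - e) * (expR a / l) + M) * A.
  have := ler_wpM2l (ltW Egt) H.
  have -> : expR a * ((1 - e) * (expR (- a) * (1 + a)) * (V * Z)) =
    (expR a * expR (- a)) * ((1 - e) * (1 + a) * (V * Z)) by ring.
  have -> : expR a * (((1 - e) / l + expR (- a) * M) * A) =
    ((1 - e) * (expR a / l) + (expR a * expR (- a)) * M) * A by ring.
  by rewrite E1 !mul1r.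
have H2 : (1 - e) * (expR a / l) <= sig * M.
  apply: (@le_trans _ _ (1 * (expR a / l))).
    by apply: ler_wpM2r; [rewrite divr_ge0// ltW|lra].
  by rewrite mul1r ler_pdivrMr// -mulrA [M * l]mulrC.
have H3 : (1 - e1) * a * (V * Z) <= (1 - e) * (1 + a) * (V * Z).
  apply: ler_wpM2r => //; nra.
have H4 : ((1 - e) * (expR a / l) + M) * A <= (1 + sig) * M * A.
  apply: ler_wpM2r => //; lra.
have H5 := le_trans H3 (le_trans H1 H4).
rewrite ler_pdivlMr//.
have -> : V / M * ((1 - e1) / (1 + sig)) * a * Z = ((1 - e1) * a * (V * Z)) / (M * (1 + sig)).
  by field; rewrite !gt_eqF.
rewrite ler_pdivrMr ?mulr_gt0//.
by have -> : A * (M * (1 + sig)) = (1 + sig) * M * A by ring.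
Qed.

Section log_partition.
Context (R : realType) (p : R) (m n : nat) (k : nat -> nat).
Hypothesis p12 : 1 < p <= 2.
Hypotheses (k0 : k 0%N = 0%N) (km : k m = n).
Hypothesis (kinc : forall j, (j < m)%N -> (k j < k j.+1)%N).
Hypothesis (n0 : (0 < n)%N).
Variables (Rad lam : R).
Hypothesis (Rad0 : 0 < Rad) (lam0 : 0 < lam).
Local Notation S := (pk_ball p m k (origin R) Rad).
Local Notation c := (Zhat p m k n S).
Local Notation V := ((Rad / r_n p m k n) ^+ n).
Local Notation eps := (lam * (2 * geo_const p n)).
(* [expR s0] is the fugacity [2 ^- n * expR (Num.sqrt n)], where the bound on the
   density becomes useful. *)
Local Notation sig := (Num.sqrt (n%:R^-1 : R)).
Local Notation s0 := (n%:R * sig - n%:R * ln 2).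

Lemma log_partition : eps < 1 -> s0 <= ln lam ->
  V / 2 ^+ n * ((1 - eps) / (1 + sig)) * (1 - n%:R^-1) * ((ln lam - s0) ^+ 2 / 2) <=
  ln (fine (gfun c lam)).
Proof.
move=> eps1 s01.
have nR : 0 < n%:R :> R by rewrite ltr0n.
have sig0 : 0 < sig by rewrite sqrtr_gt0 invr_gt0.
have sig2 : sig ^+ 2 * n%:R = 1 by rewrite sqr_sqrtr ?invr_ge0// mulVf// gt_eqF.
have [rn0 _] := r_nP p12 k0 km kinc n0.
have V0 : 0 <= V by rewrite exprn_ge0// divr_ge0// ltW.
have kap0 : 0 <= 2 * geo_const p n by rewrite mulr_ge0// geo_const_ge0.
have M0 : 0 < 2 ^+ n :> R by rewrite exprn_gt0.
have cge t : (0 <= c t)%E by exact: Zhat_ge0.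
have eps0 : 0 <= 1 - eps by rewrite subr_ge0 ltW.
have K0 : 0 <= V / 2 ^+ n * ((1 - eps) / (1 + sig)).
  by rewrite mulr_ge0// divr_ge0// ?addr_ge0// ltW.
have Zge (s : R) : 1 <= fine (gfun c (expR s)).
  by apply: (gfunr_ge1 p12 k0 km kinc n0 Rad0); exact: expR_gt0.
have Zfin (s : R) : (gfun c (expR s) < +oo)%E.
  by apply: (gfun_fin p12 k0 km kinc n0 Rad0); exact: expR_gt0.
pose f s := ln (fine (gfun c (expR s))).
pose al s := fine (gfun1 c (expR s)) / fine (gfun c (expR s)).
(* The variable is the logarithm of the fugacity. With [n] steps the discretization costs a factor
   [1 - 1 / n], which tends to [1]. *)
have := @riemann_lower R f al (V / 2 ^+ n * ((1 - eps) / (1 + sig))) s0 (ln lam) n n0 s01 K0.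
rewrite /f lnK ?posrE//; apply.
- by rewrite ln_ge0.
- move=> s h ss0 h0 shs1.
  have Z1 := Zge s; have Zpos : 0 < fine (gfun c (expR s)) by exact: lt_le_trans Z1.
  have Zh1 := Zge (s + h); have Zhpos : 0 < fine (gfun c (expR (s + h))) by exact: lt_le_trans Zh1.
  have A1 : (gfun1 c (expR s) < +oo)%E.
    by apply: (gfun1_fin p12 k0 km kinc n0 Rad0); exact: expR_gt0.
  have Zhf := Zfin (s + h); rewrite expRD in Zhf.
  have := gfun_convex cge (expR_gt0 s) h0 (Zfin s) Zpos A1 Zhf.
  rewrite -expRD -/(al s) => H.
  have P1 : 0 < expR (h * al s) * fine (gfun c (expR s)) by rewrite mulr_gt0// expR_gt0.
  have := H; rewrite -ler_ln ?posrE// lnM ?posrE ?expR_gt0// expRK => H'.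
  by rewrite addrC.
- move=> s /andP[ss0 ss1].
  have es : expR s <= lam by rewrite -[lam]lnK ?posrE// ler_expR.
  have Z1 := Zge s; have Zpos : 0 < fine (gfun c (expR s)) by exact: lt_le_trans Z1.
  have a0 : 0 <= s - s0 by rewrite subr_ge0.
  have ee : expR s * (2 * geo_const p n) <= eps by rewrite ler_wpM2r.
  have e1 := le_lt_trans ee eps1.
  (* The parameter is [a = s - s0], that is, [log (2 ^+ n * expR s)] minus the square root of
     [n]. *)
  have := density_real p12 k0 km kinc n0 Rad0 (expR_gt0 s) a0 e1.
  have A0 : 0 <= fine (gfun1 c (expR s)).
    by apply: fine_ge0; apply: gfun1_ge0 => //; exact: expR_ge0.
  apply: (density_ratio (expR_gt0 s) a0 _ ee (ltW eps1) Zpos A0 V0 M0 (ltW sig0)).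
    by rewrite mulr_ge0 ?expR_ge0.
  rewrite (_ : expR s * 2 ^+ n = expR (s + n%:R * ln 2)); last first.
    by rewrite expRD expRM_natl lnK ?posrE.
  have -> : s - s0 = - (n%:R * sig) + (s + n%:R * ln 2) by ring.
  rewrite [leLHS]expRD; apply: ler_wpM2r; first exact: expR_ge0.
  rewrite expRN -[leRHS]invrK lef_pV2 ?posrE ?expR_gt0 ?invr_gt0//.
  (* The calibration of [sig]: [n * sig] is its inverse, and an exponential exceeds its argument, so
     the void term is at most [sig] times the crowded one. *)
  have -> : sig^-1 = n%:R * sig.
    apply: (mulfI (x := sig)); first by rewrite gt_eqF.
    by rewrite mulfV ?gt_eqF// mulrCA -expr2 mulrC sig2.
  apply: le_trans (expR_ge1Dx _); lra.
Qed.

End log_partition.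

(** As [d <= 1], the factor [th] costs at most [(1 - th) / 2] and the shift by [s] at most [s]. This
    dictates the form of [rate]. *)
Lemma error_absorbed (R : realType) (d s th : R) : 0 <= d <= 1 -> 0 <= s -> 0 <= th <= 1 ->
  d ^+ 2 / 2 + - ((1 - th) + 2 * s) / 2 <= th * ((d - s) ^+ 2 / 2).
Proof.
move=> /andP[d0 d1] s0 /andP[t0 t1].
have h1 : d ^+ 2 <= 1 by nra.
have h2 : (1 - th) * d ^+ 2 <= (1 - th) * 1 by rewrite ler_wpM2l// subr_ge0.
have h3 : 2 * s * (th * d) <= 2 * s * 1 by rewrite ler_wpM2l ?mulr_ge0//; nra.
have h4 : 0 <= th * s ^+ 2 by rewrite mulr_ge0// sqr_ge0.
nra.
Qed.

(** The cases in which the density bound gives nothing: the claimed bound is nonpositive there, and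
    [log Z >= 0] suffices. *)
Lemma error_dominates (R : realType) (d s th : R) : 0 <= d <= 1 -> 0 <= s -> th <= 1 ->
  d < s \/ th = 0 -> d ^+ 2 / 2 + - ((1 - th) + 2 * s) / 2 <= 0.
Proof. by move=> /andP[d0 d1] s0 t1 [ds|->]; nra. Qed.

(** * The error sequence and the pressure *)

Section rate.
Context (R : realType) (p : R).
Hypothesis p12 : 1 < p <= 2.
Local Notation theta := (cvx_radius p).

(** Ratio of the growth [2 * theta] of the overlap bound to the base [1 + theta] of the largest
    fugacity; [lam * kappa] is at most [4 * decay ^+ n]. *)
Definition decay : R := 2 * theta / (1 + theta).
Definition inv_sqrt (n : nat) : R := Num.sqrt (n%:R^-1).
(* Truncated at [0] so as to remain valid when [lam * (2 * geo_const p n) >= 1], that is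
   when [n] is too small for the density bound to say anything. *)
Definition quality (n : nat) : R :=
  Num.max 0 ((1 - 4 * decay ^+ n) * (1 - n%:R^-1) / (1 + inv_sqrt n)).
Definition rate (n : nat) : R := - ((1 - quality n) + 2 * inv_sqrt n) / 2.

Lemma decay_bounds : 0 <= decay < 1.
Proof.
have /andP[t0 t1] := cvx_radius_bounds p12.
have t2 : 0 < 1 + theta by lra.
rewrite /decay; apply/andP; split; first by rewrite divr_ge0//; lra.
by rewrite ltr_pdivrMr//; lra.
Qed.

Lemma inv_sqrt_cvg : inv_sqrt @ \oo --> 0.
Proof.
rewrite -(cvg_shiftS inv_sqrt).
have := @continuous_cvg _ _ _ _ _ (@harmonic R) (@Num.sqrt R) 0
  (@sqrt_continuous R 0) cvg_harmonic.
by move=> h; rewrite sqrtr0 in h; exact: h.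
Qed.

Lemma quality_cvg : quality n @[n --> \oo] --> (1 : R).
Proof.
(* The maximum with [0] is written through the absolute value, whose continuity gives the limit. *)
have -> : quality = fun n => (((1 - 4 * decay ^+ n) * (1 - n%:R^-1) / (1 + inv_sqrt n)) +
   `|(1 - 4 * decay ^+ n) * (1 - n%:R^-1) / (1 + inv_sqrt n)|) / 2.
  apply/funext => n; rewrite /quality; set x := _ / _.
  by have [x0|x0] := leP 0 x; [rewrite ger0_norm//; lra|rewrite ltr0_norm//; lra].
have inv_cvg : (fun n => n%:R^-1 : R) @ \oo --> (0 : R).
  by rewrite -(cvg_shiftS (fun n => n%:R^-1 : R)); exact: cvg_harmonic.
have /andP[b0 b1] := decay_bounds.
have base : (fun n => (1 - 4 * decay ^+ n) * (1 - n%:R^-1) / (1 + inv_sqrt n)) @ \oo --> (1 : R).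
  rewrite [X in _ --> X](_ : 1 = (1 - 4 * 0) * (1 - 0) / (1 + 0)); last first.
    by rewrite mulr0 !subr0 addr0 mulr1 divr1.
  apply: cvgM; last first.
    apply: cvgV; first by rewrite addr0 oner_neq0.
    by apply: cvgD; [exact: cvg_cst|exact: inv_sqrt_cvg].
  apply: cvgM; apply: cvgB; try exact: cvg_cst; last exact: inv_cvg.
  apply: cvgM; first exact: cvg_cst.
  by apply: cvg_expr; rewrite ger0_norm.
rewrite [X in _ --> X](_ : 1 = (1 + `|1|) / 2); last by rewrite normr1; lra.
apply: cvgM; last exact: cvg_cst.
by apply: cvgD => //; exact: cvg_norm.
Qed.

Lemma rate_cvg : rate n @[n --> \oo] --> (0 : R).
Proof.
rewrite [X in _ --> X](_ : 0 = - ((1 - 1) + 2 * 0) / 2); last by rewrite mulr0 subrr addr0 oppr0 mul0r.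
apply: cvgM; last exact: cvg_cst.
apply: cvgN; apply: cvgD.
  by apply: cvgB; [exact: cvg_cst|exact: quality_cvg].
by apply: cvgM; [exact: cvg_cst|exact: inv_sqrt_cvg].
Qed.

Lemma inv_sqrt_ge0 n : 0 <= inv_sqrt n.
Proof. exact: sqrtr_ge0. Qed.

Lemma quality_ge0 n : 0 <= quality n.
Proof. by rewrite /quality le_max lexx. Qed.

Lemma inv_le1 n : (0 < n)%N -> 0 <= 1 - n%:R^-1 :> R.
Proof. by move=> n0; rewrite subr_ge0 invf_le1 ?ltr0n// ler1n. Qed.

Lemma quality_le e n : (0 < n)%N -> e <= 4 * decay ^+ n -> e <= 1 ->
  quality n <= (1 - e) / (1 + inv_sqrt n) * (1 - n%:R^-1).
Proof.
move=> n0 he e1; have s0 := inv_sqrt_ge0 n; have i0 := inv_le1 n0.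
have i1 : 0 <= (1 + inv_sqrt n)^-1 by rewrite invr_ge0; lra.
rewrite /quality ge_max; apply/andP; split.
  by rewrite !mulr_ge0// subr_ge0.
by rewrite mulrAC !ler_wpM2r//; lra.
Qed.

Lemma quality_le1 n : (0 < n)%N -> quality n <= 1.
Proof.
move=> n0; have s0 := inv_sqrt_ge0 n; have i0 := inv_le1 n0.
have /andP[b0 _] := decay_bounds.
apply: (@le_trans _ _ ((1 - 0) / (1 + inv_sqrt n) * (1 - n%:R^-1))).
  by apply: quality_le => //; rewrite mulr_ge0// exprn_ge0.
rewrite subr0 mul1r mulr_ile1 ?invr_ge0//; first lra.
by rewrite invf_le1; lra.
Qed.

Lemma quality_eq0 n e : (0 < n)%N -> e <= 4 * decay ^+ n -> 1 <= e ->
  quality n = 0.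
Proof.
move=> n0 he e1; have s0 := inv_sqrt_ge0 n; have i0 := inv_le1 n0.
rewrite /quality; apply/max_idPl; rewrite -mulrA mulr_le0_ge0//; first lra.
by rewrite mulr_ge0// invr_ge0; lra.
Qed.

Lemma geo_small n lam : (0 < n)%N -> 0 <= lam <= (1 + theta) ^- n ->
  lam * (2 * geo_const p n) <= 4 * decay ^+ n.
Proof.
move=> n0 /andP[l0 l1].
have /andP[t0 t1] := cvx_radius_bounds p12.
have h : geo_const p n <= 2 * (2 * theta) ^+ n.
  have : 1 <= (2 * theta) ^+ n by rewrite exprn_ege1//; lra.
  by rewrite /geo_const; set x := _ ^+ n; lra.
apply: (@le_trans _ _ ((1 + theta) ^- n * (2 * (2 * (2 * theta) ^+ n)))).
  rewrite ler_pM// ?mulr_ge0// ?geo_const_ge0//.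
  by rewrite ler_wpM2l.
by rewrite /decay expr_div_n; lra.
Qed.

End rate.

Section pressure_bound.
Context (R : realType) (p : R) (m n : nat) (k : nat -> nat).
Hypothesis p12 : 1 < p <= 2.
Hypotheses (k0 : k 0%N = 0%N) (km : k m = n).
Hypothesis (kinc : forall j, (j < m)%N -> (k j < k j.+1)%N).
Hypothesis (n0 : (0 < n)%N).
Variable lam : R.
Hypothesis lamP : 2 ^- n < lam <= (1 + cvx_radius p) ^- n.
Local Notation d := (ln 2 + n%:R^-1 * ln lam).
Local Notation s := (inv_sqrt R n).

Let lam0 : 0 < lam.
Proof. by case/andP: lamP => h _; rewrite (lt_trans _ h)// invr_gt0 exprn_gt0. Qed.

Let n0R : (0 : R) < n%:R. Proof. by rewrite ltr0n. Qed.

Lemma log_fugacity_bounds : 0 <= d <= 1.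
Proof.
have /andP[h1 h2] := lamP; have /andP[t0 t1] := cvx_radius_bounds p12.
have lam1 : lam <= 1.
  by rewrite (le_trans h2)// invf_le1 ?exprn_gt0 ?exprn_ege1//; lra.
have : n%:R * - ln (2 : R) <= ln lam.
  rewrite mulrN mulr_natl -lnXn// -lnV ?posrE ?exprn_gt0//.
  by rewrite ler_ln ?posrE// ?invr_gt0 ?exprn_gt0// (ltW h1).
rewrite -ler_pdivlMl// => h3.
have h4 : n%:R^-1 * ln lam <= 0.
  by rewrite mulr_ge0_le0// ?invr_ge0 ?(ltW n0R)// ln_le0.
have h5 : ln (2 : R) <= 1 by rewrite (le_trans (@le_ln1Dx R 1 _))//; lra.
by apply/andP; split; lra.
Qed.

Lemma ball_pressure (Rad : R) : 0 < Rad ->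
  (d ^+ 2 / 2 + rate p n) * (n%:R ^+ 2 / 2 ^+ n) <=
  (fine (vol n (pk_ball p m k (origin R) Rad)))^-1 *
    ln (fine (Zpart p m k n (pk_ball p m k (origin R) Rad) lam)).
Proof.
move=> Rad0; rewrite (ball_volE p12 k0 km kinc n0 Rad0)/=.
have lnZ : 0 <= ln (fine (Zpart p m k n (pk_ball p m k (origin R) Rad) lam)).
  by apply: ln_ge0; exact: (gfunr_ge1 p12 k0 km kinc n0 Rad0 lam0).
set V := (_ / _) ^+ n.
have V0 : 0 < V by rewrite exprn_gt0// divr_gt0//; case: (r_nP p12 k0 km kinc n0).
have n2 : 0 <= n%:R ^+ 2 / 2 ^+ n :> R by rewrite divr_ge0// exprn_ge0.
have d01 := log_fugacity_bounds.
have s0 := inv_sqrt_ge0 R n.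
have geo : lam * (2 * geo_const p n) <= 4 * decay p ^+ n.
  by apply: geo_small => //; rewrite (ltW lam0); case/andP: lamP.
have q0 := quality_ge0 p n; have q1 := quality_le1 p12 n0.
have trivial_case : d ^+ 2 / 2 + rate p n <= 0 ->
  (d ^+ 2 / 2 + rate p n) * (n%:R ^+ 2 / 2 ^+ n) <=
  V^-1 * ln (fine (Zpart p m k n (pk_ball p m k (origin R) Rad) lam)).
  move=> h; apply: (@le_trans _ _ 0); first exact: mulr_le0_ge0.
  by rewrite mulr_ge0// invr_ge0 ltW.
(* If [lam * kappa] is at least [1], the truncation has made [quality] vanish. *)
have [eps1|eps1] := leP 1 (lam * (2 * geo_const p n)).
  apply: trivial_case; rewrite /rate (quality_eq0 n0 geo eps1).
  by apply: error_dominates; rewrite ?ler01//; right.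
(* Fugacities below the starting point of the integration. *)
have [ds|ds] := ltP d s.
  by apply: trivial_case; apply: error_dominates => //; left.
have shift : ln lam - (n%:R * s - n%:R * ln 2) = n%:R * (d - s).
  by rewrite mulrBr mulrDr mulVKf ?gt_eqF//; ring.
have := log_partition p12 k0 km kinc n0 Rad0 lam0 eps1.
rewrite -[Num.sqrt _]/s -subr_ge0 shift mulr_ge0 ?(ltW n0R) ?subr_ge0// => /(_ isT).
move=> main; rewrite ler_pdivlMl//; apply: le_trans main.
have /(_ _) absorbed := @error_absorbed R d s (quality p n) d01 s0.
apply: (@le_trans _ _ (V * (quality p n * ((d - s) ^+ 2 / 2) * (n%:R ^+ 2 / 2 ^+ n)))).
  rewrite ler_wpM2l ?(ltW V0)// ler_wpM2r//; apply: absorbed.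
  by rewrite q0.
have qle := quality_le n0 geo (ltW eps1).
rewrite -/V; set A := _ / (1 + _) in qle *.
rewrite [leRHS](_ : _ = V * (A * (1 - n%:R^-1) * ((d - s) ^+ 2 / 2) * (n%:R ^+ 2 / 2 ^+ n))).
  rewrite ler_wpM2l ?(ltW V0)// ler_wpM2r// ler_wpM2r// divr_ge0// sqr_ge0//.
by rewrite exprMn; ring.
Qed.

Lemma pressure_lower :
  (((d ^+ 2 / 2 + rate p n) * (n%:R ^+ 2 / 2 ^+ n))%:E <= pressure p m k n lam)%E.
Proof.
(* The lower limit is a supremum of infima over neighbourhoods of infinity; that of the positive
   radii suffices. *)
rewrite /pressure limf_einfE; apply: le_ereal_sup_tmp; eexists.
  exists [set Rad : R | 0 < Rad]; last reflexivity.
  by exists 0; split => //; exact: real0.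
apply: le_ereal_inf_tmp => _ [Rad /= Rad0 <-].
by rewrite lee_fin; exact: ball_pressure.
Qed.

End pressure_bound.

Unset Implicit Arguments.

Theorem theorem17 (R : realType) (p : R) :
  1 < p <= 2 ->
  exists c : R, 0 < c < 2 /\
  exists eta : nat -> R, eta @ \oo --> 0 /\
  forall (n m : nat) (k : nat -> nat),
    k 0%N = 0%N -> k m = n -> (forall j, (j < m)%N -> (k j < k j.+1)%N) ->
    forall lam : R, 2 ^- n < lam <= c ^- n ->
      (((((ln 2 + n%:R^-1 * ln lam) ^+ 2) / 2 + eta n) * (n%:R ^+ 2 / 2 ^+ n))%:E
        <= pressure p m k n lam)%E.
Proof.
move=> p12; exists (1 + cvx_radius p); split.
  by have /andP[t0 t1] := cvx_radius_bounds p12; apply/andP; split; lra.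
exists (rate p); split; first exact: rate_cvg.
move=> n m k k0 km kinc lam lamP.
(* For [n = 0] both ends of the range of [lam] are [1], and the range is empty. *)
have n0 : (0 < n)%N.
  rewrite lt0n; apply/eqP => n0; move: lamP.
  by rewrite n0 !expr0 !invr1 => /andP[/lt_le_trans h /h]; rewrite ltxx.
exact: pressure_lower.
Qed.
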